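(* Let $\mathbb{X},\mathbb{U},\mathbb{V},\mathbb{Z}$ be real Hilbert spaces, $f\in\mathbb{V}^*$, let $a(\xi;\cdot,\cdot)\in\mathcal{L}(\mathbb{V}\times\mathbb{V};\mathbb{R})$ be a continuous bilinear form for each $\xi\in\mathbb{X}$, $b(\cdot,\cdot)\in\mathcal{L}(\mathbb{U}\times\mathbb{V};\mathbb{R})$ a continuous bilinear form, $\mathbb{U}_h\subset\mathbb{U}$ a finite-dimensional subspace, $\hat{\mathbb{V}}\subseteq\mathbb{V}$ a closed subspace, and $\hat{\mathbb{K}}:=\{v\in\hat{\mathbb{V}}:b(w_h,v)=0\ \forall w_h\in\mathbb{U}_h\}$. Assume there are $\beta_h>0$ and, for each $\xi\in\mathbb{X}$, $\alpha_h(\xi)>0$ such that $$\inf_{v_1\in\hat{\mathbb{K}}}\sup_{v_2\in\hat{\mathbb{K}}}\frac{a(\xi;v_1,v_2)}{\|v_1\|_{\mathbb{V}}\|v_2\|_{\mathbb{V}}}\ge\alpha_h(\xi),\qquad\{v_2\in\hat{\mathbb{K}}:a(\xi;v_1,v_2)=0\ \forall v_1\in\hat{\mathbb{K}}\}=\{0\},$$ $$\inf_{w_h\in\mathbb{U}_h}\sup_{v\in\hat{\mathbb{V}}}\frac{b(w_h,v)}{\|w_h\|_{\mathbb{U}}\|v\|_{\mathbb{V}}}\ge\beta_h,$$ so that for every $\xi\in\mathbb{X}$ the state problem: find $(r,u_h)\in\hat{\mathbb{V}}\times\mathbb{U}_h$ with $$a(\xi;r,v)+b(u_h,v)=f(v)\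 \ \forall v\in\hat{\mathbb{V}},\qquad b(w_h,r)=0\ \ \forall w_h\in\mathbb{U}_h,$$ has a unique solution, whose second component is denoted $u_{h,\xi}$. Assume that the map $A:\mathbb{X}\to\mathcal{L}(\hat{\mathbb{V}},\hat{\mathbb{V}}^* )$, $A(\xi)\hat v:=a(\xi;\hat v,\cdot)$, is Gâteaux differentiable on $\mathbb{X}$, that $A(\cdot)$, $A'(\cdot)$ and $\alpha_h^{-1}(\cdot)$ are uniformly bounded on $\mathbb{X}$, and that $A'(\cdot)$ is Lipschitz continuous. Let $Q\in\mathcal{L}(\mathbb{U};\mathbb{Z})$, $z_o\in\mathbb{Z}$, $\alpha>0$, $$J(w_h,\xi)=\tfrac12\|Q(w_h)-z_o\|_{\mathbb{Z}}^2+\tfrac{\alpha}{2}\|\xi\|_{\mathbb{X}}^2,\qquad j(\xi)=J(u_{h,\xi},\xi).$$ If $\alpha$ is sufficiently large (i.e. $\alpha>\alpha_0$ for some $\alpha_0\ge0$ independent of $\alpha$), then $j'$ is Lipschitz continuous with some constant $L>0$, $j$ is strongly convex with some constant $\gamma>0$, and: (i) $j$ has a unique minimizer $\bar\xi\in\mathbb{X}$, and $j'(\bar\xi)=0$ in $\mathbb{X}^*$. (ii) For any nonempty subset $\mathcal{M}_n\subset\mathbb{X}$ and any $\delta_n>0$, the constrained control problem has a quasi-minimizer $\bar\xi_n\in\mathcal{M}_n$, i.e. $$J(u_{h,\bar\xi_n},\bar\xi_n)\le\inf_{\xi_n\in\mathcal{M}_n}J(u_{h,\xi_n},\xi_n)+\frac{\delta_n}{2}.$$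 (iii) Any such quasi-minimizer satisfies $$\|\bar\xi-\bar\xi_n\|_{\mathbb{X}}\le\left(\frac{L}{\gamma}\inf_{\xi_n\in\mathcal{M}_n}\|\bar\xi-\xi_n\|_{\mathbb{X}}^2+\frac{\delta_n}{\gamma}\right)^{1/2}.$$
   Context: A map $G$ from $\mathbb{X}$ to a Banach space $Y$ is Gâteaux differentiable at $\xi$ if $G'(\xi)\eta=\lim_{t\to0}(G(\xi+t\eta)-G(\xi))/t$ exists in $Y$ for all $\eta\in\mathbb{X}$ and $\eta\mapsto G'(\xi)\eta$ is linear and continuous. Uniform boundedness on $\mathbb{X}$ and Lipschitz continuity of $A'$ refer to the operator norm of $A'(\xi)\in\mathcal{L}(\mathbb{X},\mathcal{L}(\hat{\mathbb{V}},\hat{\mathbb{V}}^* ))$. Strong convexity of $j$ with constant $\gamma$ means $\langle j'(\xi)-j'(\eta),\xi-\eta\rangle_{\mathbb{X}^*,\mathbb{X}}\ge\gamma\|\xi-\eta\|_{\mathbb{X}}^2$ for all $\xi,\eta\in\mathbb{X}$. Infima and suprema of quotients are taken over nonzero elements. The sets $\mathcal{M}_n$ are arbitrary subsets (in applications, sets of neural-network functions, not necessarily closed). *)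

(* Defs.v *)
From HB Require Import structures.
From mathcomp Require Import all_boot all_order all_algebra sesquilinear.
From mathcomp Require Import all_classical all_reals all_analysis.

Set Implicit Arguments.
Unset Strict Implicit.
Unset Printing Implicit Defensive.

Import Order.TTheory GRing.Theory Num.Theory.
Import numFieldNormedType.Exports.

Local Open Scope classical_set_scope.
Local Open Scope ring_scope.

HB.mixin Record NormedModule_isHilbert (R : realType) X
    & NormedModule R X := {
  inner : {dot X for idfun} ;
  inner_norm : forall x : X, inner x x = `|x| ^+ 2
}.

#[short(type="hilbertType")]
HB.structure Definition Hilbert (R : realType) :=
  {X of CompleteNormedModule R X & NormedModule_isHilbert R X}.

(* The space L(V, W) of continuous linear maps, normed by the operator norm.  *)
Section ContinuousLinear.
Context {R : realType} (V W : normedModType R).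

Definition clin_pred : {pred V -> W} :=
  [pred f : V -> W | `[< linear f /\ continuous f >]].

Record clin := Clin { clin_fun :> V -> W ; _ : clin_fun \in clin_pred }.

HB.instance Definition _ := [isSub for clin_fun].
HB.instance Definition _ := [Choice of clin by <:].

Lemma clinP (f : clin) : linear f /\ continuous f.
Proof. by case: f => f /= /asboolP. Qed.

Lemma clin_continuous (f : clin) : continuous f.
Proof. by case: (clinP f). Qed.

HB.instance Definition _ (f : clin) :=
  @GRing.isLinear.Build R V W *:%R (clin_fun f) (clinP f).1.

Lemma clin_submod_closed : submod_closed clin_pred.
Proof.
split=> [|a f g /asboolP[lf cf] /asboolP[lg cg]]; apply/asboolP; split.
- by move=> a u v; rewrite [RHS]addr0 [RHS]scaler0.
- exact: cst_continuous.
- move=> b u v; rewrite -[LHS]/(a *: f _ + g _) lf lg !scalerDr !scalerA.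
  by rewrite (mulrC a b) addrACA.
- by move=> x; apply: cvgD; [apply: cvgZl_tmp; exact: cf | exact: cg].
Qed.

HB.instance Definition _ :=
  GRing.isSubmodClosed.Build R (V -> W) clin_pred clin_submod_closed.
HB.instance Definition _ := [SubChoice_isSubLmodule of clin by <:].

Definition opnorm (f : clin) : R := sup [set `|f x| | x in [set x | `|x| <= 1]].

Let opnorm_has_sup (f : clin) :
  has_sup [set `|f x| | x in [set x | `|x| <= 1]].
Proof.
split; first by exists `|f 0|, 0 => //=; rewrite normr0.
have /linear_boundedP := continuous_linear_bounded 0 (@clin_continuous f 0).
move=> /pinfty_ex_gt0[M M0 fM]; exists M => _ [x /= x1 <-].
by rewrite (le_trans (fM x))// ler_piMr// ltW.
Qed.

Lemma opnorm_ub (f : clin) x : `|f x| <= opnorm f * `|x|.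
Proof.
have [->|x0] := eqVneq x 0; first by rewrite raddf0 !normr0 mulr0.
have nx0 : 0 < `|x| by rewrite normr_gt0.
rewrite -ler_pdivrMr//; apply: (ub_le_sup (opnorm_has_sup f).2).
exists (`|x|^-1 *: x); rewrite /= ?linearZ/= normrZ ger0_norm ?invr_ge0//.
  by rewrite mulVf ?gt_eqF.
by rewrite mulrC.
Qed.

Lemma opnorm_le (f : clin) M :
  0 <= M -> (forall x, `|f x| <= M * `|x|) -> opnorm f <= M.
Proof.
move=> M0 fM; apply: ge_sup; first exact: (opnorm_has_sup f).1.
by move=> _ [x /= x1 <-]; rewrite (le_trans (fM x))// ler_piMr.
Qed.

Lemma opnorm_ge0 (f : clin) : 0 <= opnorm f.
Proof.
apply: (@le_trans _ _ `|f 0|) => //.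
apply: (ub_le_sup (opnorm_has_sup f).2).
by exists 0 => //=; rewrite normr0.
Qed.

Let opnormD f g : opnorm (f + g) <= opnorm f + opnorm g.
Proof.
apply: opnorm_le => [|x]; first by rewrite addr_ge0 ?opnorm_ge0.
by rewrite mulrDl (le_trans (ler_normD _ _))// lerD// opnorm_ub.
Qed.

Let opnormZ_le a f : opnorm (a *: f) <= `|a| * opnorm f.
Proof.
apply: opnorm_le => [|x]; first by rewrite mulr_ge0 ?opnorm_ge0.
rewrite -mulrA -[_ *: f]/(Sub _ _)/=.
by rewrite [X in `|X|]/(a *: f x) normrZ ler_wpM2l// opnorm_ub.
Qed.

Let opnormZ a f : opnorm (a *: f) = `|a| * opnorm f.
Proof.
apply/eqP; rewrite eq_le opnormZ_le/=.
have [->|a0] := eqVneq a 0; first by rewrite normr0 mul0r opnorm_ge0.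
have := opnormZ_le a^-1 (a *: f).
by rewrite scalerA mulVf// scale1r normfV ler_pdivlMl ?normr_gt0.
Qed.

Let opnorm0_eq0 f : opnorm f = 0 -> f = 0.
Proof.
move=> f0; apply/val_inj/funext => x /=; apply/eqP.
by rewrite -normr_le0 (le_trans (opnorm_ub f x))// f0 mul0r.
Qed.

HB.instance Definition _ :=
  Lmodule_isNormed.Build R clin opnormD opnormZ opnorm0_eq0.

End ContinuousLinear.

Notation "{ 'clin' V -> W }" := (clin V W)
  (V at level 98, W at level 99, format "{ 'clin'  V  ->  W }") : type_scope.

(* A closed subspace S of V coerces to the type cs_type S of its elements,    *)
(* normed by restriction of the norm of V; `val` is the inclusion into V.     *)
Section ClosedSubspace.
Context {R : realType} (V : normedModType R).

Record closed_subspace := ClosedSubspace {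
  cs_set : set V ;
  cs_submod : submod_closed (mem cs_set) ;
  cs_closed : closed cs_set
}.

Definition cs_pred (S : closed_subspace) : {pred V} := mem (cs_set S).

Record cs_type (S : closed_subspace) :=
  CsElt { cs_val : V ; _ : cs_val \in cs_pred S }.

Variable S : closed_subspace.

HB.instance Definition _ := [isSub for @cs_val S].
HB.instance Definition _ := [Choice of cs_type S by <:].
HB.instance Definition _ :=
  GRing.isSubmodClosed.Build R V (cs_pred S) (cs_submod S).
HB.instance Definition _ := [SubChoice_isSubLmodule of cs_type S by <:].

Let cs_normD (x y : cs_type S) : `|val (x + y)| <= `|val x| + `|val y|.
Proof. exact: ler_normD. Qed.

Let cs_normZ a (x : cs_type S) : `|val (a *: x)| = `|a| * `|val x|.
Proof. exact: normrZ. Qed.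

Let cs_norm0 (x : cs_type S) : `|val x| = 0 -> x = 0.
Proof. by move/normr0_eq0 => x0; exact: val_inj. Qed.

HB.instance Definition _ :=
  Lmodule_isNormed.Build R (cs_type S) cs_normD cs_normZ cs_norm0.

End ClosedSubspace.
Coercion cs_type : closed_subspace >-> Sortclass.

Definition findim_subspace {R : realType} (U : normedModType R) (S : set U) :=
  exists n (e : 'I_n -> U),
    S = [set x | exists c : 'I_n -> R, x = \sum_(i < n) c i *: e i].

(* Continuous bilinear forms, i.e. the elements of L(U x V; R).               *)
Record cbilin {R : realType} (U V : normedModType R) := CBilin {
  cbilin_fun :> U -> V -> R ;
  cbilin_bilinear : bilinear_for *%R *%R cbilin_fun ;
  cbilin_continuous : continuous (fun p : U * V => cbilin_fun p.1 p.2)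
}.

(* form_op c S is the operator v |-> c(v, .) in L(S, S'), S' the dual of S.   *)
Section FormOperator.
Context {R : realType} (V : normedModType R).
Variables (c : cbilin V V) (S : closed_subspace V).

Let c0l v : c 0 v = 0.
Proof.
have := (cbilin_bilinear c).1 v (- 1) 0 0.
by rewrite /= scaler0 addr0 mulN1r addNr.
Qed.

Let cZl k u v : c (k *: u) v = k * c u v.
Proof. by have := (cbilin_bilinear c).1 v k u 0; rewrite /= addr0 c0l addr0. Qed.

Let c0r u : c u 0 = 0.
Proof.
have := (cbilin_bilinear c).2 u (- 1) 0 0.
by rewrite /= scaler0 addr0 mulN1r addNr.
Qed.

Let cZr k u v : c u (k *: v) = k * c u v.
Proof. by have := (cbilin_bilinear c).2 u k v 0; rewrite /= addr0 c0r addr0. Qed.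

Let bnd : exists2 M, 0 <= M & forall u v, `|c u v| <= M * `|u| * `|v|.
Proof.
have /cvgrPdist_lt/(_ 1 ltr01)/nbhs_ballP[e /= e0 He] :=
  @cbilin_continuous _ _ _ c (0, 0).
have [d d0 de] : exists2 d, 0 < d & d < e.
  by exists (e / 2); rewrite ?divr_gt0// ltr_pdivrMr// ltr_pMr// ltr1n.
exists (d^-1 * d^-1) => [|u v]; first by rewrite mulr_ge0 ?invr_ge0 ?ltW.
have [->|u0] := eqVneq u 0; first by rewrite c0l !normr0 mulr0 mul0r.
have [->|v0] := eqVneq v 0; first by rewrite c0r !normr0 mulr0.
have nu : 0 < `|u| by rewrite normr_gt0.
have nv : 0 < `|v| by rewrite normr_gt0.
have small (w : V) : w != 0 -> ball (0 : V) e ((d / `|w|) *: w).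
  move=> w0; rewrite -ball_normE /= sub0r normrN normrZ.
  have dw : 0 <= d / `|w| by exact: divr_ge0 (ltW d0) (normr_ge0 w).
  by rewrite (ger0_norm dw) -mulrA mulVf ?normr_eq0// mulr1.
have /= := He ((d / `|u|) *: u, (d / `|v|) *: v) (conj (small u u0) (small v v0)).
rewrite c0l sub0r normrN cZl cZr mulrA normrM.
have p0 : 0 < d / `|u| * (d / `|v|) by rewrite mulr_gt0 ?divr_gt0.
rewrite (gtr0_norm p0) -ltr_pdivlMl// mulr1 => /ltW/le_trans; apply.
by rewrite !invfM !invrK mulrACA !mulrA.
Qed.

Let row_clin (v : S) :
  (fun w : S => c (val v) (val w)) \in @clin_pred R S R.
Proof.
have lin : linear_for *:%R (fun w : S => c (val v) (val w)).
  by move=> k x y; exact: (cbilin_bilinear c).2.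
apply/asboolP; split=> //.
pose g : {linear S -> R} := HB.pack (fun w : S => c (val v) (val w))
  (GRing.isLinear.Build R S R *:%R _ lin).
apply: (bounded_linear_continuous (f := g)); apply/linear_boundedP.
have [M M0 cM] := bnd.
exists (M * `|val v|); split=> [|r /ltW Mr x]; first exact: num_real.
exact: le_trans (cM _ _) (ler_wpM2r _ Mr).
Qed.

Definition form_row (v : S) : {clin S -> R} := Clin (row_clin v).

Let op_clin : form_row \in @clin_pred R S {clin S -> R}.
Proof.
have lin : linear form_row.
  move=> k x y; apply/val_inj/funext => w /=.
  by rewrite (cbilin_bilinear c).1.
apply/asboolP; split=> //.
pose g : {linear S -> {clin S -> R}} := HB.pack form_row
  (GRing.isLinear.Build R S {clin S -> R} *:%R _ lin).
apply: (bounded_linear_continuous (f := g)); apply/linear_boundedP.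
have [M M0 cM] := bnd.
exists M; split=> [|r /ltW Mr x]; first exact: num_real.
apply: (le_trans _ (ler_wpM2r (normr_ge0 x) Mr)).
by apply: opnorm_le => [|w]; [exact: mulr_ge0|exact: cM].
Qed.

Definition form_op : {clin S -> {clin S -> R}} := Clin op_clin.

End FormOperator.

Section Notions.
Context {R : realType}.

Definition is_gateaux (X Y : normedModType R) (G : X -> Y) (xi : X)
    (dG : {clin X -> Y}) : Prop :=
  forall eta, derivable G xi eta /\ 'D_eta G xi = dG eta.

(* inf-sup constant of a form over the nonzero elements of S1 and S2; it is   *)
(* valued in \bar R, so that an empty inf is +oo and an empty sup is -oo.     *)
Definition infsup (W1 W2 : normedModType R) (c : W1 -> W2 -> R)
    (S1 : set W1) (S2 : set W2) : \bar R :=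
  ereal_inf [set ereal_sup [set (c w1 w2 / (`|w1| * `|w2|))%:E
                           | w2 in S2 `&` [set w | w != 0]]
            | w1 in S1 `&` [set w | w != 0]].

Definition strongly_convex_deriv (X : normedModType R)
    (dj : X -> {clin X -> R}) (gamma : R) : Prop :=
  forall xi eta, gamma * `|xi - eta| ^+ 2 <= (dj xi - dj eta) (xi - eta).

Definition minimizer (X : Type) (j : X -> R) (xi : X) : Prop :=
  forall eta, j xi <= j eta.

Definition quasi_minimizer (X : Type) (j : X -> R) (M : set X) (delta : R)
    (xi : X) : Prop :=
  M xi /\ j xi <= inf [set j eta | eta in M] + delta / 2.

End Notions.

Section StateProblem.
Context {R : realType} (U V X Z : normedModType R).
Variables (a : X -> cbilin V V) (b : cbilin U V) (f : {clin V -> R}).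
Variables (Uh : set U) (Vh : closed_subspace V).

Definition kernel_b : set Vh :=
  [set v | forall wh, Uh wh -> b wh (val v) = 0].

Definition state_problem (xi : X) (p : Vh * U) : Prop :=
  [/\ Uh p.2,
      forall v : Vh, a xi (val p.1) (val v) + b p.2 (val v) = f (val v)
    & forall wh, Uh wh -> b wh (val p.1) = 0].

(* Second component of the solution; meaningful only where the state problem   *)
(* is uniquely solvable, `get` returning an arbitrary element otherwise.      *)
Definition state_u (xi : X) : U := (get (state_problem xi)).2.

Definition cost (Q : {clin U -> Z}) (zo : Z) (alpha : R) (w : U) (xi : X) : R :=
  2^-1 * `|Q w - zo| ^+ 2 + alpha / 2 * `|xi| ^+ 2.

Definition reduced_cost (Q : {clin U -> Z}) (zo : Z) (alpha : R) (xi : X) : R :=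
  cost Q zo alpha (state_u xi) xi.

End StateProblem.

(* Main.v *)
Require Import Defs.
From HB Require Import structures.
From mathcomp Require Import all_boot all_order all_algebra sesquilinear.
From mathcomp Require Import all_classical all_reals all_analysis.
From mathcomp Require Import ring lra.
Set Implicit Arguments.
Unset Strict Implicit.
Unset Printing Implicit Defensive.
Import Order.TTheory GRing.Theory Num.Theory.
Import numFieldNormedType.Exports.
Local Open Scope classical_set_scope.
Local Open Scope ring_scope.

(* The inf-sup conditions bound every solution of the saddle-point problem by *)
(* its data, uniformly in xi. Differences of states, the candidate derivative *)
(* (the solution of the linearized problem) and the Taylor remainder all      *)
(* solve saddle-point problems with the form at xi, hence are bounded too.    *)
(* Therefore xi |-> 1/2 |Q u_xi - z_o|^2 has a K-Lipschitz derivative and     *)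
(* Taylor remainder at most K/2 |h|^2. For alpha > K the reduced cost lies    *)
(* between quadratics with leading coefficients gamma/2 = (alpha - K)/2 and   *)
(* L/2 = (alpha + K)/2, which yields the minimizer and the error estimate.    *)

(** Everything rests on the stability of saddle-point problems ([saddle_bound]): testing with kernel
    elements bounds the first component, and the inf-sup condition on the constraint form then
    bounds the second. Existence ([saddle_exists]) combines [babuska_necas] on the kernel with
    [kernel_annihilator], a best approximation in a finite-dimensional range. The stability constant
    does not depend on the control, so [saddle_solution_smooth] turns the bounds on A and A' into
    bounds on the state map and its derivative, and [tracking_smooth] passes them to the tracking
    term. The resulting K depends only on the state problem, Q and z_o, hence can serve as alpha_0.

    No weak compactness is used: if a function lies above each of its tangents by a fixed multiple
    of the squared distance, its minimizing sequences are Cauchy ([strongly_convex_minimizer]). This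
    one lemma yields the optimal control and also, through quadratic energies, the Lax-Milgram,
    Riesz and Babuska-Necas theorems.

    For the error estimate ([quasi_minimizer_dist]), stationarity at the minimizer xb leaves gamma/2
    |xb - x|^2 <= j x - j xb <= L/2 |xb - y|^2 + delta/2 for a quasi-minimizer x and every y in M;
    it remains to take the infimum over y. *)

Section Inner.
Context {R : realType} {X : hilbertType R}.
Implicit Types x y z : X.

Lemma innerC x y : inner x y = inner y x.
Proof. by rewrite hermitian_subproof expr0 mul1r. Qed.

Lemma innerDr x y z : inner x (y + z) = inner x y + inner x z.
Proof. exact: linearDr. Qed.

Lemma innerBr x y z : inner x (y - z) = inner x y - inner x z.
Proof. exact: linearBr. Qed.

Lemma innerZr k x y : inner x (k *: y) = k * inner x y.
Proof. exact: (linearZr_LR inner). Qed.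

Lemma innerDl x y z : inner (x + y) z = inner x z + inner y z.
Proof. by rewrite innerC innerDr !(innerC z). Qed.

Lemma innerBl x y z : inner (x - y) z = inner x z - inner y z.
Proof. by rewrite innerC innerBr !(innerC z). Qed.

Lemma innerZl k x y : inner (k *: x) y = k * inner x y.
Proof. by rewrite innerC innerZr (innerC y). Qed.

Lemma inner0r x : inner x 0 = 0.
Proof. exact: linear0r. Qed.

Lemma inner_eq0 x : inner x x = 0 -> x = 0.
Proof. by rewrite inner_norm => /eqP; rewrite expf_eq0/= normr_eq0 => /eqP. Qed.

Lemma normD_sqr x y : `|x + y| ^+ 2 = `|x| ^+ 2 + 2 * inner x y + `|y| ^+ 2.
Proof. by rewrite -!inner_norm !(innerDl, innerDr) (innerC y x); ring. Qed.

(** The squared norm of |v|^2 u - (u,v) v equals |v|^2 (|u|^2 |v|^2 - (u,v)^2) and is nonnegative.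
    In [key] the factor |v|^2 is kept so that v = 0 needs no separate hypothesis. *)
Lemma inner_le x y : `|inner x y| <= `|x| * `|y|.
Proof.
have nn (u : X) : 0 <= `|u| by [].
have key (u v : X) : `|v| ^+ 2 * `|inner u v| <= `|v| ^+ 2 * (`|u| * `|v|).
  have : 0 <= inner (`|v| ^+ 2 *: u - inner u v *: v)
                   (`|v| ^+ 2 *: u - inner u v *: v).
    by rewrite inner_norm sqr_ge0.
  rewrite !(innerBl, innerBr, innerZl, innerZr) !inner_norm (innerC v u) => h.
  have {}h : 0 <= (`|v|^+2) * ((`|u| * `|v|) ^+ 2 - inner u v ^+ 2).
    by apply: le_trans h _; rewrite le_eqVlt; apply/orP; left; apply/eqP; ring.
  have [v0|v0] := eqVneq `|v| 0; first by rewrite v0 expr0n/= !mul0r.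
  have v2 : 0 < `|v| ^+ 2 by rewrite exprn_gt0// lt_def v0/=.
  rewrite ler_pM2l// -ler_sqr ?nnegrE ?mulr_ge0//.
  by rewrite real_normK ?num_real//; move: h; rewrite pmulr_rge0// subr_ge0.
have [->|y0] := eqVneq y 0; first by rewrite inner0r !normr0 mulr0.
by have := key x y; rewrite ler_pM2l// exprn_gt0// normr_gt0.
Qed.

End Inner.

(** * Continuous linear maps given by a bound *)

Section ClinConstruction.
Context {R : realType} {V W : normedModType R}.

Lemma bounded_linear_clin (f : V -> W) (M : R) :
  linear f -> (forall x, `|f x| <= M * `|x|) -> f \in @clin_pred R V W.
Proof.
move=> lf fM; apply/asboolP; split=> //.
pose g : {linear V -> W} := HB.pack f (GRing.isLinear.Build R V W *:%R _ lf).
apply: (bounded_linear_continuous (f := g)); apply/linear_boundedP.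
exists M; split=> [|r /ltW Mr x]; first exact: num_real.
exact: le_trans (fM _) (ler_wpM2r _ Mr).
Qed.

Definition mk_clin (f : V -> W) (M : R) (lf : linear f)
  (fM : forall x, `|f x| <= M * `|x|) : {clin V -> W} :=
  Clin (bounded_linear_clin lf fM).

Lemma clin_ub (f : {clin V -> W}) x : `|f x| <= `|f| * `|x|.
Proof. exact: opnorm_ub. Qed.

Lemma clin_le (f : {clin V -> W}) M :
  0 <= M -> (forall x, `|f x| <= M * `|x|) -> `|f| <= M.
Proof. exact: opnorm_le. Qed.

Lemma clinD (f g : {clin V -> W}) x : (f + g) x = f x + g x.
Proof. by []. Qed.

Lemma clinN (f : {clin V -> W}) x : (- f) x = - f x.
Proof. by []. Qed.

Lemma clinB (f g : {clin V -> W}) x : (f - g) x = f x - g x.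
Proof. by []. Qed.

Lemma clinZ k (f : {clin V -> W}) x : (k *: f) x = k *: f x.
Proof. by []. Qed.

Lemma clin_argD (f : {clin V -> W}) x y : f (x + y) = f x + f y.
Proof. exact: raddfD. Qed.

Lemma clin_argB (f : {clin V -> W}) x y : f (x - y) = f x - f y.
Proof. exact: raddfB. Qed.

Lemma clin_argZ (f : {clin V -> W}) k x : f (k *: x) = k *: f x.
Proof. exact: linearZ. Qed.

Lemma clin_ext (f g : {clin V -> W}) : (forall x, f x = g x) -> f = g.
Proof. by move=> fg; apply/val_inj/funext. Qed.

End ClinConstruction.

Lemma clin_formZ (R : realType) (V : normedModType R) (F : {clin V -> R}) k x :
  F (k *: x) = k * F x.
Proof. exact: linearZ. Qed.

(** * Closed subspaces as Hilbert spaces *)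

Section ClosedSubspaceHilbert.
Context {R : realType} {V : hilbertType R} (S : closed_subspace V).

(** The image of a Cauchy filter under the inclusion converges in V, and its limit stays in the
    closed set. With the inherited inner product, the solvability results for Hilbert spaces then
    apply on [Vh] and on the kernel inside it. *)
Lemma cs_complete (F : set_system S) :
  ProperFilter F -> cauchy F -> cvg F.
Proof.
move=> FF /cauchy_ballP Fc.
have /cauchy_cvg : cauchy ((val : S -> V) @ F).
  apply/cauchy_ballP => e e0.
  by rewrite near_map2; have := Fc e e0; rewrite -!ball_normE.
move=> /cvg_ex[x Fx].
have Sx : x \in cs_pred S.
  apply/mem_set; apply: (closed_cvg (cs_set S) (@cs_closed _ _ S) _ x Fx).
  by apply: nearW => y; apply/set_mem; exact: valP y.
apply/cvg_ex; exists (CsElt Sx); apply/cvgrPdist_lt => e e0.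
by have /cvgrPdist_lt/(_ e e0) := Fx.
Qed.

HB.instance Definition _ := Uniform_isComplete.Build (cs_type S) cs_complete.

Definition cs_inner (x y : S) : R := inner (val x) (val y).

Lemma cs_inner_bilinear :
  bilinear_for *%R (idfun \; *%R) cs_inner.
Proof.
split=> [y k x x'|x k y y']; rewrite /cs_inner/=.
  by rewrite innerDl innerZl.
by rewrite innerDr innerZr.
Qed.

HB.instance Definition _ :=
  bilinear_isBilinear.Build R S S R *%R (idfun \; *%R) cs_inner
    cs_inner_bilinear.

Lemma cs_inner_hermitian (x y : S) :
  cs_inner x y = (-1) ^+ false * idfun (cs_inner y x).
Proof. by rewrite expr0 mul1r /cs_inner innerC. Qed.

HB.instance Definition _ :=
  isHermitianSesquilinear.Build R S false idfun cs_inner cs_inner_hermitian.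

Lemma cs_inner_gt0 (x : S) : x != 0 -> 0 < cs_inner x x.
Proof.
move=> x0; rewrite /cs_inner inner_norm exprn_gt0// normr_gt0.
by apply: contra x0 => /eqP x0; apply/eqP/val_inj.
Qed.

HB.instance Definition _ := isDotProduct.Build R S cs_inner cs_inner_gt0.

Lemma cs_inner_norm (x : S) : cs_inner x x = `|x| ^+ 2.
Proof. by rewrite /cs_inner inner_norm. Qed.

HB.instance Definition _ :=
  NormedModule_isHilbert.Build R (cs_type S) cs_inner_norm.

End ClosedSubspaceHilbert.

(** * Minimization of strongly convex functions *)

Section StronglyConvex.
Context {R : realType} {X : completeNormedModType R}.
Variables (j : X -> R) (d : X -> {clin X -> R}) (g : R).
Hypothesis g_gt0 : 0 < g.
Hypothesis j_above :
  forall x y, j x + d x (y - x) + g / 2 * `|y - x| ^+ 2 <= j y.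

(** The lower bounds based at the midpoint m are added at x and at y: the linear terms cancel
    because y - m = -(x - m), and |x - m| is half of |x - y|. *)
Lemma strongly_convex_midpoint x y :
  2 * j (2^-1 *: (x + y)) + g / 4 * `|x - y| ^+ 2 <= j x + j y.
Proof.
set m := _ *: _.
have xm : x - m = 2^-1 *: (x - y).
  by apply: (@scalerI _ _ 2) => //; rewrite /m !(scalerBr, scalerDr) !scalerA
    divff// !scale1r (_ : 2 *: x = x + x) ?opprD ?addrA ?addrK//
    scalerDl scale1r.
have mm : m + m = x + y.
  by rewrite -scalerDl (_ : _ + _ = 1) ?scale1r//; field.
have ym : y - m = - (x - m).
  by apply/eqP; rewrite -addr_eq0 addrACA -opprD mm [y + x]addrC subrr.
have h1 := j_above m x; have h2 := j_above m y.
have dm : d m (y - m) = - d m (x - m) by rewrite ym raddfN.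
move: h1 h2; rewrite dm ym normrN xm normrZ gtr0_norm ?invr_gt0// exprMn.
lra.
Qed.

(** The midpoint inequality makes a minimizing sequence Cauchy. Its limit is a minimizer because the
    tangent bound at the limit acts as lower semicontinuity: the linear term along the sequence
    tends to 0. *)
Lemma strongly_convex_minimizer (m : R) :
  (forall x, m <= j x) -> exists x, minimizer j x.
Proof.
move=> jm; set i := inf (range j).
have hi : has_inf (range j).
  by split; [exists (j 0), 0 | exists m => _ [x _ <-]].
have ij x : i <= j x by apply: ge_inf; [exact: hi.2 | exists x].
have /choice[s sP] (n : nat) : exists x, j x < i + n.+1%:R^-1.
  have [|_ [x _ <-] xi] := @inf_adherent _ _ n.+1%:R^-1 _ hi.
    by rewrite invr_gt0.
  by exists x.
have sN N n : (N <= n)%N -> j (s n) < i + N.+1%:R^-1.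
  by move=> Nn; rewrite (lt_le_trans (sP n))// lerD2l lef_pV2 ?posrE ?ler_nat.
have /cauchy_cvg/cvg_ex[x sx] : cauchy (s n @[n --> \oo]).
  apply/cauchy_exP => e e0.
  (* Both values exceed the infimum by less than g/8 e^2, so the midpoint inequality leaves g/4 |s N
     - s n|^2 < g/4 e^2. *)
  have e8 : 0 < g / 8 * e ^+ 2 by rewrite mulr_gt0 ?divr_gt0 ?exprn_gt0.
  have [N _ /(_ N (leqnn N)) /= HN] := near_infty_natSinv_lt (PosNum e8).
  have {}HN : N.+1%:R^-1 < g / 8 * e ^+ 2 := HN.
  exists (s N); near=> n; rewrite /= -ball_normE /=.
  have Nn : (N <= n)%N by near: n; exact: nbhs_infty_ge.
  have := strongly_convex_midpoint (s N) (s n).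
  have := ij (2^-1 *: (s N + s n)); have := sN N N (leqnn N); have := sN N n Nn.
  move=> h1 h2 h3 h4; rewrite -ltr_sqr ?nnegrE// ?(ltW e0)//.
  have : g / 4 * `|s N - s n| ^+ 2 < g / 4 * e ^+ 2.
    by move: N.+1%:R^-1 h1 h2 HN => q h1 h2 HN; lra.
  by rewrite ltr_pM2l// divr_gt0.
exists x => y; apply: le_trans _ (ij y).
apply/ler_addgt0Pr => e e0.
have e2 : 0 < e / 2 by rewrite divr_gt0.
near \oo => n.
(* Adding 1 keeps the divisor positive when [d x] vanishes. *)
have d0 : 0 < `|d x| + 1 by rewrite ltr_wpDl.
have h1 : `|x - s n| < e / 2 / (`|d x| + 1).
  by near: n; apply: cvgr_dist_lt => //; rewrite !divr_gt0.
have h2 : n.+1%:R^-1 < e / 2.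
  by near: n; exact: (near_infty_natSinv_lt (PosNum e2)).
have h3 := j_above x (s n); have h4 := sP n.
have h5 : - (e / 2) <= d x (s n - x).
  have := clin_ub (d x) (s n - x); rewrite ler_norml distrC => /andP[+ _].
  apply: le_trans; rewrite lerN2 mulrC.
  move: h1; rewrite ltr_pdivlMr// => /ltW; apply: le_trans.
  by rewrite ler_wpM2l// lerDl.
have h6 : 0 <= g / 2 * `|s n - x| ^+ 2.
  by rewrite mulr_ge0 ?sqr_ge0// divr_ge0// ltW.
by move: n.+1%:R^-1 h2 h4 => q h2 h4; lra.
Unshelve. all: by end_near. Qed.

End StronglyConvex.

(** At t = -c / (|e| + 1) the expression is a negative multiple of c^2. *)
Lemma quadratic_ge0_eq0 (R : realFieldType) (c e : R) :
  (forall t, 0 <= t * c + t ^+ 2 * e) -> c = 0.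
Proof.
move=> h; apply/eqP; rewrite -sqrf_eq0 eq_le sqr_ge0 andbT.
have p : 0 < `|e| + 1 by rewrite ltr_wpDl.
have := h (- c / (`|e| + 1)).
have -> : - c / (`|e| + 1) * c + (- c / (`|e| + 1)) ^+ 2 * e =
  - (c ^+ 2 * (`|e| + 1 - e) / (`|e| + 1) ^+ 2) by field; rewrite gt_eqF.
rewrite oppr_ge0 pmulr_lle0 ?invr_gt0 ?exprn_gt0// pmulr_lle0//.
by rewrite subr_gt0 (le_lt_trans (ler_norm e))// ltrDl.
Qed.

(** Along each line t h, minimality and the upper quadratic bound give 0 <= t d(h) + t^2 C |h|^2 for
    all t, which forces d(h) = 0. *)
Lemma minimizer_stationary (R : realType) (X : normedModType R) (j : X -> R)
    (d : {clin X -> R}) (C : R) (x : X) :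
  minimizer j x ->
  (forall h, j (x + h) <= j x + d h + C * `|h| ^+ 2) -> d = 0.
Proof.
move=> jx jC; apply: clin_ext => h.
apply: (@quadratic_ge0_eq0 _ _ (C * `|h| ^+ 2)) => t.
have := le_trans (jx (x + t *: h)) (jC (t *: h)).
rewrite normrZ exprMn real_normK ?num_real// clin_formZ.
rewrite -addrA lerDl => /le_trans; apply.
by rewrite le_eqVlt; apply/orP; left; apply/eqP; ring.
Qed.

(** * Lax-Milgram, Riesz and Babuska-Necas theorems *)

Section LaxMilgram.
Context {R : realType} {H : completeNormedModType R}.
Variables (B : {clin H -> {clin H -> R}}) (F : {clin H -> R}) (g : R).
Hypotheses (g_gt0 : 0 < g) (B_sym : forall x y, B x y = B y x).
Hypothesis B_coercive : forall x, g * `|x| ^+ 2 <= B x x.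

Let j x := 2^-1 * B x x - F x.

Let j_taylor x h : j (x + h) = j x + (B x - F) h + 2^-1 * B h h.
Proof.
rewrite /j clinB !clin_argD !clinD (B_sym h x).
by field.
Qed.

(** By symmetry the energy [j] has derivative [B x - F] and the exact second-order term B h h / 2.
    Coercivity makes it strongly convex and bounded below, and stationarity of its minimizer is the
    equation. *)
Lemma symmetric_lax_milgram : exists x, B x = F.
Proof.
have [||x jx] := @strongly_convex_minimizer _ _ j (fun x => B x - F) g g_gt0 _
    (- (`|F| ^+ 2 / (2 * g))) _.
- move=> x y; have := j_taylor x (y - x); rewrite subrKC => ->; rewrite lerD2l.
  by rewrite mulrAC mulrC ler_pM2l ?invr_gt0.
- move=> x; rewrite /j; have := B_coercive x; have := clin_ub F x.
  rewrite ler_norml => /andP[_ Fx] Bx.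
  (* Completing the square in g/2 |x|^2 - |F| |x| produces the lower bound -|F|^2 / (2g). *)
  have : 0 <= g / 2 * (`|x| - `|F| / g) ^+ 2.
    by rewrite mulr_ge0 ?sqr_ge0// divr_ge0// ltW.
  have -> : g / 2 * (`|x| - `|F| / g) ^+ 2 =
      g * `|x| ^+ 2 / 2 - `|F| * `|x| + `|F| ^+ 2 / (2 * g).
    by field; rewrite gt_eqF.
  lra.
exists x; apply/eqP; rewrite -subr_eq0; apply/eqP.
apply: (@minimizer_stationary _ _ j _ (2^-1 * `|B|) x jx) => h.
rewrite j_taylor lerD2l -mulrA ler_pM2l ?invr_gt0//.
apply: le_trans (ler_norm _) _; apply: le_trans (clin_ub _ _) _.
by rewrite expr2 mulrA ler_wpM2r// clin_ub.
Qed.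

End LaxMilgram.

Section Riesz.
Context {R : realType} {H : hilbertType R}.
Implicit Types (x y : H) (F G : {clin H -> R}).

Let inner_linear x : linear (inner x : H -> R).
Proof. by move=> k y z; rewrite innerDr innerZr. Qed.

Definition inner_clin x : {clin H -> R} :=
  mk_clin (inner_linear x) (inner_le x).

Lemma inner_clin_linear : linear inner_clin.
Proof.
move=> k x y; apply: clin_ext => z.
by rewrite clinD clinZ /= innerDl innerZl.
Qed.

Lemma inner_clin_bound x : `|inner_clin x| <= 1 * `|x|.
Proof. by apply: clin_le => [|y]; rewrite mul1r//; exact: inner_le. Qed.

(** This is [symmetric_lax_milgram] for the inner product itself, coercive with constant 1. *)
Lemma riesz_representation F : exists x, forall y, inner x y = F y.
Proof.
have [||x xF] := @symmetric_lax_milgram _ _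
  (mk_clin inner_clin_linear inner_clin_bound) F 1 ltr01.
- by move=> x y; exact: innerC.
- by move=> x; rewrite mul1r /= inner_norm.
by exists x => y; rewrite -xF.
Qed.

Definition riesz F : H := sval (cid (riesz_representation F)).

Lemma rieszP F y : inner (riesz F) y = F y.
Proof. exact: (svalP (cid (riesz_representation F))). Qed.

Lemma inner_inj x y : (forall z, inner x z = inner y z) -> x = y.
Proof.
move=> xy; apply/eqP; rewrite -subr_eq0; apply/eqP/inner_eq0.
by rewrite innerBl xy subrr.
Qed.

Lemma riesz_linear : linear riesz.
Proof.
move=> k F G; apply: inner_inj => z.
by rewrite innerDl innerZl !rieszP clinD clinZ.
Qed.

(** One inequality is Cauchy-Schwarz, the other evaluates F at its own representative. *)
Lemma norm_riesz F : `|riesz F| = `|F|.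
Proof.
apply/eqP; rewrite eq_le; apply/andP; split; last first.
  by apply: clin_le => // y; rewrite -rieszP inner_le.
have [->|r0] := eqVneq (riesz F) 0; first by rewrite normr0.
have := clin_ub F (riesz F); rewrite -rieszP inner_norm ger0_norm ?sqr_ge0//.
by rewrite expr2 ler_pM2r// normr_gt0.
Qed.

HB.instance Definition _ :=
  GRing.isLinear.Build R {clin H -> R} H *:%R riesz riesz_linear.

End Riesz.

Section BabuskaNecas.
Context {R : realType} {H : hilbertType R}.
Variables (T : {clin H -> {clin H -> R}}) (g : R).
Hypotheses (g_gt0 : 0 < g) (T_below : forall x, g * `|x| <= `|T x|).
Hypothesis T_nondeg : forall y, (forall x, T x y = 0) -> y = 0.

Let adj_linear (F : {clin H -> R}) : linear (fun y => F (riesz (T y))).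
Proof. by move=> k x y; rewrite !linearP. Qed.

Let adj_bound (F : {clin H -> R}) y : `|F (riesz (T y))| <= `|F| * `|T| * `|y|.
Proof.
apply: le_trans (clin_ub _ _) _; rewrite norm_riesz -mulrA ler_wpM2l//.
exact: clin_ub.
Qed.

(** [adj F y] is the inner product of [F] and [T y] in the dual space; thus [fun x => adj (T x)] is
    the symmetric operator of the normal equations, and [adj F] their right-hand side. *)
Let adj F : {clin H -> R} := mk_clin (adj_linear F) (adj_bound F).

Let normal_linear : linear (fun x => adj (T x)).
Proof.
by move=> k x y; apply: clin_ext => z; rewrite clinD clinZ/= linearP.
Qed.

Let normal_bound x : `|adj (T x)| <= `|T| * `|T| * `|x|.
Proof.
apply: clin_le => [|y]; first by rewrite !mulr_ge0.
apply: le_trans (adj_bound _ _) _; rewrite ler_wpM2r// mulrAC ler_wpM2r//.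
exact: clin_ub.
Qed.

(* The least-squares functional [|T x - F|^2] is coercive, and its normal     *)
(* equations force [T x = F] by injectivity of the transpose.                 *)
Lemma babuska_necas (F : {clin H -> R}) : exists x, T x = F.
Proof.
have [|||x xF] := @symmetric_lax_milgram _ _
  (mk_clin normal_linear normal_bound) (adj F) (g ^+ 2).
- by rewrite exprn_gt0.
- by move=> x y /=; rewrite -!rieszP innerC.
- move=> x /=; rewrite -rieszP inner_norm norm_riesz -exprMn.
  by rewrite ler_sqr ?nnegrE// mulr_ge0// ltW.
exists x; apply/eqP; rewrite -subr_eq0; apply/eqP.
suff r0 : riesz (T x - F) = 0.
  by apply/eqP; rewrite -normr_eq0 -norm_riesz r0 normr0.
apply: T_nondeg => y; rewrite -rieszP innerC rieszP clinB.
have : adj (T x) y = adj F y by rewrite -xF.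
by move=> /= ->; rewrite subrr.
Qed.

End BabuskaNecas.

(** * Saddle-point problems under inf-sup conditions *)

(** Gram-Schmidt by induction: the last vector and y are first made orthogonal to the earlier
    vectors, giving z and w, and then the component of w along z is removed. The vectors may be
    linearly dependent. *)
Lemma finite_projection (R : realType) (H : hilbertType R) n (x : 'I_n -> H)
    (y : H) :
  exists c : 'I_n -> R, forall k, inner (y - \sum_(i < n) c i *: x i) (x k) = 0.
Proof.
elim: n x y => [|n IHn] x y; first by exists (fun=> 0) => -[].
pose x' (i : 'I_n) := x (widen_ord (leqnSn n) i).
have [a aP] := IHn x' (x ord_max); have [b bP] := IHn x' y.
set z := x ord_max - _ in aP; set w := y - _ in bP.
(* If z = 0, division by zero returns 0 and nothing is removed. *)
pose t := inner w z / inner z z.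
have wz : inner (w - t *: z) z = 0.
  rewrite innerBl innerZl /t; have [->|z0] := eqVneq z 0.
    by rewrite !inner0r mulr0 subrr.
  rewrite divfK ?subrr//.
  by apply: contra z0 => /eqP/inner_eq0 ->.
have wx k : inner (w - t *: z) (x' k) = 0.
  by rewrite innerBl innerZl aP bP mulr0 subrr.
(* Expanding z in t z shifts the earlier coefficients by - t a. *)
pose c (i : 'I_n.+1) := if unlift ord_max i is Some k then b k - t * a k else t.
have cE : y - \sum_(i < n.+1) c i *: x i = w - t *: z.
  rewrite big_ord_recr/= /c unlift_none.
  rewrite (eq_bigr (fun i => b i *: x' i - t *: (a i *: x' i))); last first.
    move=> i _; rewrite (_ : widen_ord _ i = lift ord_max i) ?liftK; last first.
      by apply/val_inj; rewrite /= /bump leqNgt ltn_ord.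
    by rewrite scalerBl scalerA /x' (_ : widen_ord _ i = lift ord_max i)//;
      apply/val_inj; rewrite /= /bump leqNgt ltn_ord.
  rewrite sumrB -scaler_sumr /w /z scalerBr !opprD !opprK !addrA.
  by rewrite -!addrA; congr (_ + (_ + _)); rewrite addrC.
exists c => k; rewrite cE.
have [i ->|->] := unliftP ord_max k.
  rewrite (_ : lift ord_max i = widen_ord (leqnSn n) i); first exact: wx.
  by apply/val_inj; rewrite /= /bump leqNgt ltn_ord.
rewrite -[x ord_max](subrK (\sum_(i < n) a i *: x' i)) -/z innerDr wz add0r.
have -> : inner (w - t *: z) (\sum_(i < n) a i *: x' i) =
    inner_clin (w - t *: z) (\sum_(i < n) a i *: x' i) by [].
rewrite raddf_sum big1// => i _.
by apply: etrans (innerZr _ _ _) _; rewrite wx mulr0.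
Qed.

Section Restriction.
Context {R : realType} {H W : normedModType R} (S : closed_subspace H).

Let restr_linear (F : {clin H -> W}) : linear (fun x : S => F (val x)).
Proof. by move=> k x y; rewrite -clin_argZ -clin_argD. Qed.

Let restr_bound (F : {clin H -> W}) (x : S) : `|F (val x)| <= `|F| * `|x|.
Proof. exact: clin_ub. Qed.

Definition clin_restr F : {clin S -> W} :=
  mk_clin (restr_linear F) (restr_bound F).

End Restriction.

Section Saddle.
Context {R : realType} {H : hilbertType R} {U : normedModType R}.
Variables (B : {linear U -> {clin H -> R}}) (Uh : set U).

Definition saddle_kernel : set H := [set v | forall w, Uh w -> B w v = 0].

(** Operator and right-hand side are parameters because differences of states, linearized states and
    Taylor remainders solve the same problem with other data. *)
Definition saddle_solution (T : {clin H -> {clin H -> R}}) (F : {clin H -> R})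
    (p : H * U) : Prop :=
  [/\ Uh p.2, forall v, T p.1 v + B p.2 v = F v & saddle_kernel p.1].

Lemma saddle_kernel_submod : submod_closed (mem saddle_kernel).
Proof.
split=> [|k x y]; first by apply/mem_set => w _; rewrite raddf0.
move=> /set_mem Kx /set_mem Ky; apply/mem_set => w Uw.
by rewrite clin_argD clin_argZ Kx// Ky// addr0 scaler0.
Qed.

Lemma saddle_kernel_closed : closed saddle_kernel.
Proof.
have -> : saddle_kernel = \bigcap_(w in Uh) (B w @^-1` [set 0]).
  by apply/seteqP; split.
apply: closed_bigI => w _; apply: closed_comp; last exact: closed_eq.
by move=> x _; exact: clin_continuous.
Qed.

Definition saddle_kernel_cs : closed_subspace H :=
  ClosedSubspace saddle_kernel_submod saddle_kernel_closed.

Lemma findim_subspaceP (k : R) u w :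
  findim_subspace Uh -> Uh u -> Uh w -> Uh (k *: u + w).
Proof.
move=> [n [e ->]] [c ->] [c' ->]; exists (fun i => k * c i + c' i).
rewrite scaler_sumr -big_split/=; apply: eq_bigr => i _.
by rewrite scalerDl scalerA.
Qed.

Hypothesis Uh_findim : findim_subspace Uh.

(* The residual [v] of the best approximation of [G] by some [B u] lies in    *)
(* the kernel, so [|v|^2 = (G - B u) v] vanishes.                             *)
Lemma kernel_annihilator (G : {clin H -> R}) :
  (forall v, saddle_kernel v -> G v = 0) -> exists2 u, Uh u & B u = G.
Proof.
move=> GK; have [n [e UhE]] := Uh_findim.
have [c cP] := finite_projection (fun i => riesz (B (e i))) (riesz G).
pose u := \sum_(i < n) c i *: e i.
have Uu : Uh u by rewrite UhE; exists c.
exists u => //; set v := _ - _ in cP.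
have rE a : riesz (B (\sum_(i < n) a i *: e i)) =
    \sum_(i < n) a i *: riesz (B (e i)).
  by rewrite !linear_sum; apply: eq_bigr => i _; rewrite !linearZ.
have vE : v = riesz (G - B u) by rewrite raddfB/= rE.
have Kv : saddle_kernel v.
  move=> w; rewrite UhE => -[a ->].
  rewrite -rieszP innerC rE -[LHS]/(inner_clin v (\sum_(i < n) _)).
  rewrite linear_sum big1// => i _.
  by apply: etrans (innerZr _ _ _) _; rewrite cP mulr0.
have : inner v v = 0.
  by rewrite {1}vE rieszP clinB GK// Kv// subrr.
move=> /inner_eq0 v0; apply/eqP; rewrite eq_sym -subr_eq0 -normr_eq0.
by rewrite -norm_riesz -vE v0 normr0.
Qed.

Variables (alpha beta MT : R).
Hypotheses (alpha_gt0 : 0 < alpha) (beta_gt0 : 0 < beta) (MT_ge0 : 0 <= MT).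
Hypothesis B_below : forall u M, Uh u -> 0 <= M ->
  (forall v, B u v <= M * `|v|) -> beta * `|u| <= M.

(* The inf-sup condition on the kernel is stated without suprema: every upper *)
(* bound [M] of [T r v / |v|] is at least [alpha * |r|].                      *)
Definition kernel_stable (T : {clin H -> {clin H -> R}}) : Prop :=
  (forall r M, saddle_kernel r -> 0 <= M ->
     (forall v, saddle_kernel v -> T r v <= M * `|v|) -> alpha * `|r| <= M) /\
  (forall v, saddle_kernel v ->
     (forall r, saddle_kernel r -> T r v = 0) -> v = 0).

(** The two summands come from |r| <= |F| / alpha and |u| <= (|F| + MT |r|) / beta; their sum serves
    both components. *)
Definition saddle_const : R := alpha^-1 + beta^-1 * (1 + MT * alpha^-1).

Lemma saddle_const_ge0 : 0 <= saddle_const.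
Proof.
have a0 : 0 <= alpha^-1 by rewrite invr_ge0 ltW.
have b0 : 0 <= beta^-1 by rewrite invr_ge0 ltW.
by rewrite /saddle_const addr_ge0// mulr_ge0// addr_ge0// mulr_ge0.
Qed.

(** Kernel test functions eliminate the multiplier, so stability on the kernel bounds [p.1]; then B
    u = F - T r and the inf-sup condition for [B] bound [p.2]. *)
Lemma saddle_bound T F p : kernel_stable T -> `|T| <= MT ->
  saddle_solution T F p ->
  `|p.1| <= saddle_const * `|F| /\ `|p.2| <= saddle_const * `|F|.
Proof.
move=> [Ts _] TM [Up pF pK].
have r_le : `|p.1| <= alpha^-1 * `|F|.
  rewrite ler_pdivlMl//; apply: Ts => // v Kv.
  have := pF v; rewrite Kv// addr0 => ->.
  exact: le_trans (ler_norm _) (clin_ub _ _).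
have u_le : `|p.2| <= beta^-1 * (1 + MT * alpha^-1) * `|F|.
  rewrite -mulrA ler_pdivlMl//; apply: B_below => //.
    by rewrite mulr_ge0// addr_ge0// mulr_ge0// invr_ge0 ltW.
  move=> v; have -> : B p.2 v = F v - T p.1 v by rewrite -pF addrC addKr.
  rewrite mulrDl mul1r mulrDl lerD//.
    exact: le_trans (ler_norm _) (clin_ub _ _).
  rewrite (le_trans (ler_norm _))// normrN (le_trans (clin_ub _ _))//.
  rewrite ler_wpM2r// (le_trans (clin_ub _ _))// -mulrA ler_pM//.
have h0 : 0 <= alpha^-1 * `|F| by rewrite mulr_ge0// invr_ge0 ltW.
have h1 : 0 <= beta^-1 * (1 + MT * alpha^-1) * `|F| by exact: le_trans u_le.
rewrite /saddle_const mulrDl; split.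
  by rewrite (le_trans r_le)// lerDl.
by rewrite (le_trans u_le)// lerDr.
Qed.

(** The equation restricted to the kernel is solved by [babuska_necas]. The residual F - T r then
    vanishes on the kernel and is therefore some [B u]. *)
Lemma saddle_exists T F : kernel_stable T -> exists p, saddle_solution T F p.
Proof.
move=> [Ts Tn]; pose K := saddle_kernel_cs.
have KP (x : K) : saddle_kernel (val x) by apply/set_mem; exact: valP x.
have elt v : saddle_kernel v -> exists x : K, val x = v.
  by move=> /mem_set Kv; exists (@CsElt _ _ K v Kv).
have tl : linear (fun x : K => clin_restr K (T (val x))).
  move=> k x y; apply: clin_ext => z.
  by rewrite /= clin_argD clin_argZ.
have tb (x : K) : `|clin_restr K (T (val x))| <= `|T| * `|x|.
  apply: clin_le => [|z]; first by rewrite mulr_ge0.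
  by rewrite (le_trans (clin_ub (T (val x)) (val z)))// ler_wpM2r// clin_ub.
have [||r rF] := @babuska_necas _ K (mk_clin tl tb) alpha alpha_gt0 _ _
  (clin_restr K F).
- move=> x; apply: Ts => // v Kv; have [z <-] := elt v Kv.
  exact: le_trans (ler_norm _) (clin_ub (clin_restr K (T (val x))) z).
- move=> y Ty; apply: val_inj; apply: Tn => // r Kr; have [z <-] := elt r Kr.
  exact: Ty z.
have [v Kv|u Uu uE] := @kernel_annihilator (F - T (val r)).
  have [z <-] := elt v Kv; rewrite clinB.
  have : clin_restr K (T (val r)) z = clin_restr K F z by rewrite -rF.
  by move=> /= ->; rewrite subrr.
exists (val r, u); split=> [//|v|] /=; last exact: KP.
by rewrite uE clinB addrC subrK.
Qed.

(** The change of operator is moved to the right-hand side as (T1 - T2) applied to the second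
    solution, so the difference is a solution for [T1]. *)
Lemma saddle_solutionB T1 T2 F1 F2 (G : {clin H -> R}) p1 p2 :
  saddle_solution T1 F1 p1 -> saddle_solution T2 F2 p2 ->
  (forall v, G v = F1 v - F2 v - (T1 p2.1 v - T2 p2.1 v)) ->
  saddle_solution T1 G (p1 - p2).
Proof.
move=> [U1 s1 K1] [U2 s2 K2] GE; split=> [|v|w Uw] /=.
- by rewrite addrC -scaleN1r; exact: findim_subspaceP.
- rewrite GE -s1 -s2 clin_argB raddfB !clinB; lra.
- by rewrite clin_argB K1// K2// subrr.
Qed.

Lemma saddle_solutionP T k F1 F2 p1 p2 :
  saddle_solution T F1 p1 -> saddle_solution T F2 p2 ->
  saddle_solution T (k *: F1 + F2) (k *: p1 + p2).
Proof.
move=> [U1 s1 K1] [U2 s2 K2]; split=> [|v|w Uw] /=.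
- exact: findim_subspaceP.
- rewrite -[RHS]/(k * F1 v + F2 v) -s1 -s2 clin_argD clin_argZ linearP.
  rewrite -[LHS]/(k * T p1.1 v + T p2.1 v + (k * B p1.2 v + B p2.2 v)).
  by rewrite mulrDr addrACA.
- by rewrite clin_argD clin_argZ K1// K2// addr0 scaler0.
Qed.

Lemma saddle_unique T F p q : kernel_stable T -> `|T| <= MT ->
  saddle_solution T F p -> saddle_solution T F q -> p = q.
Proof.
move=> Ts TM sp sq.
have s0 : saddle_solution T 0 (p - q).
  by apply: saddle_solutionB sp sq _ => v; rewrite !subrr.
have := saddle_bound Ts TM s0; rewrite normr0 mulr0 !normr_le0 !subr_eq0.
case=> /eqP p1 /eqP p2.
by rewrite (surjective_pairing p) p1 p2 -surjective_pairing.
Qed.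

End Saddle.

(** * Gateaux derivatives and Taylor estimates for operators *)

Section Gateaux.
Context {R : realType} {X Y : normedModType R}.
Implicit Types (G : X -> Y) (dG : {clin X -> Y}) (x h : X).

Lemma is_gateauxP G x dG :
  is_gateaux G x dG <->
  forall h, t^-1 *: (G (t *: h + x) - G x) @[t --> (0 : R)^'] --> dG h.
Proof.
split=> [Gx h|Gx h]; first by have [dGx <-] := Gx h; exact: dGx.
split; first by apply/cvg_ex; exists (dG h); exact: Gx.
by apply: cvg_lim; [exact: norm_hausdorff|exact: Gx].
Qed.

Lemma is_gateaux_quadratic G x dG C :
  (forall h, `|G (x + h) - G x - dG h| <= C * `|h| ^+ 2) -> is_gateaux G x dG.
Proof.
move=> GC; apply/is_gateauxP => h; apply/cvgrPdist_lt => e e0.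
have p : 0 < `|C| * `|h| ^+ 2 + 1 by rewrite ltr_wpDl// mulr_ge0.
near=> t.
have t0 : t != 0 by near: t; exact: nbhs_dnbhs_neq.
have te : `|t| < e / (`|C| * `|h| ^+ 2 + 1).
  near: t; apply: dnbhs0_lt; exact: divr_gt0.
have -> : dG h - t^-1 *: (G (t *: h + x) - G x) =
    - (t^-1 *: (G (x + t *: h) - G x - dG (t *: h))).
  by rewrite clin_argZ [in RHS]scalerBr scalerA mulVf// scale1r opprB
      [x + _]addrC.
rewrite normrN normrZ normfV mulrC ltr_pdivrMr ?normr_gt0//.
apply: le_lt_trans (GC _) _; rewrite normrZ exprMn mulrCA.
rewrite [`|t| ^+ 2]expr2 -mulrA [e * _]mulrC ltr_pM2l ?normr_gt0//.
move: te; rewrite ltr_pdivlMr//; apply: le_lt_trans.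
rewrite ler_wpM2l// (@le_trans _ _ (`|C| * `|h| ^+ 2))// ?lerDl//.
by rewrite ler_wpM2r ?ler_norm.
Unshelve. all: by end_near. Qed.

(** The mean value theorem is scalar, so it is applied to t |-> E (G (x + t h)) for a continuous
    functional E. *)
Lemma gateaux_mvt (G : X -> Y) (dG : X -> {clin X -> Y})
    (E : {clin Y -> R}) x h :
  (forall y, is_gateaux G y (dG y)) ->
  exists2 c : R, 0 <= c <= 1 & E (G (x + h) - G x) = E (dG (x + c *: h) h).
Proof.
move=> Gd; pose f (t : R) := E (G (x + t *: h)).
have df (t : R) : is_derive t 1 f (E (dG (x + t *: h) h)).
  have /is_gateauxP/(_ h) := Gd (x + t *: h).
  move=> /(cvg_comp _ E)/(_ (@clin_continuous _ _ _ E _)) lim_f.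
  have fE : (fun s => s^-1 *: ((f \o shift t) (s *: 1) - f t)) =
      E \o (fun s => s^-1 *: (G (s *: h + (x + t *: h)) - G (x + t *: h))).
    apply/funext => s /=; rewrite clin_argZ clin_argB /f.
    by rewrite [s *: 1]mulr1 scalerDl addrCA.
  split; rewrite /derivable /derive fE.
    by apply/cvg_ex; eexists; exact: lim_f.
  by apply: cvg_lim; [exact: norm_hausdorff|exact: lim_f].
have [|c] := @MVT_segment _ f _ 0 1 ler01 (fun t _ => df t).
  apply: derivable_within_continuous => t _.
  exact: (@ex_derive _ _ _ _ _ _ _ (df t)).
rewrite in_itv/= /f scale1r scale0r addr0 subr0 mulr1 -clin_argB => c01 cE.
by exists c.
Qed.

End Gateaux.

Section OperatorTaylor.
Context {R : realType} {X H W : normedModType R}.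
Variables (T : X -> {clin H -> {clin W -> R}}).
Variables (dT : X -> {clin X -> {clin H -> {clin W -> R}}}).
Hypothesis T_gateaux : forall x, is_gateaux T x (dT x).

Let eval_linear v w : linear (fun S : {clin H -> {clin W -> R}} => S v w).
Proof. by move=> k S1 S2; rewrite !clinD !clinZ. Qed.

Let eval_bound v w (S : {clin H -> {clin W -> R}}) :
  `|S v w| <= `|v| * `|w| * `|S|.
Proof.
by rewrite mulrC mulrA (le_trans (clin_ub _ _))// ler_wpM2r// clin_ub.
Qed.

Lemma clin2_le (S : {clin H -> {clin W -> R}}) M :
  0 <= M -> (forall v w, `|S v w| <= M * `|v| * `|w|) -> `|S| <= M.
Proof.
by move=> M0 SM; apply: clin_le => // v; apply: clin_le => //; rewrite mulr_ge0.
Qed.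

Lemma clin2_ub (S : {clin H -> {clin W -> R}}) v w :
  `|S v w| <= `|S| * `|v| * `|w|.
Proof. by rewrite (le_trans (clin_ub _ _))// ler_wpM2r// clin_ub. Qed.

(** The mean value theorem is applied to each evaluation S |-> S v w. The intermediate point depends
    on v and w, the resulting bound does not. *)
Lemma operator_lipschitz M x h : (forall x, `|dT x| <= M) ->
  `|T (x + h) - T x| <= M * `|h|.
Proof.
move=> dTM; have M0 : 0 <= M := le_trans (normr_ge0 _) (dTM 0).
apply: clin2_le => [|v w]; first by rewrite mulr_ge0.
have [c _ cE] :=
  gateaux_mvt (mk_clin (@eval_linear v w) (@eval_bound v w)) x h T_gateaux.
move: cE => /= ->; apply: le_trans (clin2_ub _ _ _) _.
rewrite !ler_wpM2r// (le_trans (clin_ub _ _))// ler_wpM2r//.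
exact: dTM.
Qed.

(** Tested on v and w, the remainder is (dT (x + c h) - dT x) h with 0 <= c <= 1, so the Lipschitz
    bound supplies the second factor |h|. *)
Lemma operator_taylor k x h : (forall x y, `|dT x - dT y| <= k * `|x - y|) ->
  `|T (x + h) - T x - dT x h| <= k * `|h| ^+ 2.
Proof.
(* No sign is assumed for [k], but this product dominates a norm. *)
move=> dTk; have kh : 0 <= k * `|h|.
  by have := le_trans (normr_ge0 _) (dTk h 0); rewrite subr0.
apply: clin2_le => [|v w]; first by rewrite expr2 mulrA mulr_ge0.
have [c /andP[c0 c1] cE] :=
  gateaux_mvt (mk_clin (@eval_linear v w) (@eval_bound v w)) x h T_gateaux.
have {}cE : (T (x + h) - T x) v w = dT (x + c *: h) h v w := cE.
have -> : (T (x + h) - T x - dT x h) v w = (dT (x + c *: h) - dT x) h v w.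
  by move: cE; rewrite !clinB => ->.
apply: le_trans (clin2_ub _ _ _) _; rewrite 2?ler_wpM2r//.
rewrite expr2 mulrA (le_trans (clin_ub _ _))// ler_wpM2r//.
rewrite (le_trans (dTk _ _))// addrAC subrr add0r normrZ (ger0_norm c0).
by rewrite mulrCA ler_piMl.
Qed.

End OperatorTaylor.

(* The last clause encodes differentiability, quantitatively.                 *)
Definition smooth_bounded (R : realType) (X Y : normedModType R) (u : X -> Y)
    (D : X -> {clin X -> Y}) (c : R) : Prop :=
  [/\ forall x, `|u x| <= c,
      forall x y, `|u x - u y| <= c * `|x - y|,
      forall x h, `|D x h| <= c * `|h|,
      forall x y h, `|D x h - D y h| <= c * `|x - y| * `|h|
    & forall x h, `|u (x + h) - u x - D x h| <= c * `|h| ^+ 2].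

(** * Differentiability of the parameter-to-state map *)

Section ParametricSaddle.
Context {R : realType} {X : normedModType R} {H : hilbertType R}.
Context {U : normedModType R}.
Variables (B : {linear U -> {clin H -> R}}) (Uh : set U).
Variables (T : X -> {clin H -> {clin H -> R}}).
Variables (dT : X -> {clin X -> {clin H -> {clin H -> R}}}).
Variables (F : {clin H -> R}) (p : X -> H * U).
Variables (alpha beta MT M k : R).
Hypothesis Uh_findim : findim_subspace Uh.
Hypotheses (alpha_gt0 : 0 < alpha) (beta_gt0 : 0 < beta).
Hypothesis B_below : forall u N, Uh u -> 0 <= N ->
  (forall v, B u v <= N * `|v|) -> beta * `|u| <= N.
Hypothesis T_stable : forall x, kernel_stable B Uh alpha (T x).
Hypothesis T_bound : forall x, `|T x| <= MT.
Hypothesis T_gateaux : forall x, is_gateaux T x (dT x).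
Hypothesis dT_bound : forall x, `|dT x| <= M.
Hypothesis dT_lip : forall x y, `|dT x - dT y| <= k * `|x - y|.
Hypothesis pP : forall x, saddle_solution B Uh (T x) F (p x).

Let MT_ge0 : 0 <= MT. Proof. exact: le_trans (normr_ge0 _) (T_bound 0). Qed.
Let M_ge0 : 0 <= M. Proof. exact: le_trans (normr_ge0 _) (dT_bound 0). Qed.

Let C := saddle_const alpha beta MT.

Let C_ge0 : 0 <= C.
Proof. exact: saddle_const_ge0. Qed.

Let sol_bound x G q N : saddle_solution B Uh (T x) G q ->
  `|G| <= N -> `|q.1| <= C * N /\ `|q.2| <= C * N.
Proof.
move=> sq GN; have [h1 h2] := saddle_bound alpha_gt0 beta_gt0 MT_ge0 B_below
  (T_stable x) (T_bound x) sq.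
by split; [apply: (le_trans h1)|apply: (le_trans h2)]; rewrite ler_wpM2l.
Qed.

Let sol_diff x y F1 F2 p1 p2 N :
  saddle_solution B Uh (T x) F1 p1 -> saddle_solution B Uh (T y) F2 p2 ->
  `|F1 - F2 - (T x - T y) p2.1| <= N ->
  `|p1.1 - p2.1| <= C * N /\ `|p1.2 - p2.2| <= C * N.
Proof.
move=> s1 s2 GN.
have s : saddle_solution B Uh (T x) (F1 - F2 - (T x - T y) p2.1) (p1 - p2).
  by apply: saddle_solutionB s1 s2 _ => // v; rewrite !clinB.
exact: sol_bound s GN.
Qed.

Let r x := (p x).1.
Let c0 := C * `|F|.

Let c0_ge0 : 0 <= c0. Proof. by rewrite mulr_ge0. Qed.

Let p_bound x : `|r x| <= c0 /\ `|(p x).2| <= c0.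
Proof. exact: sol_bound (pP x) (lexx _). Qed.

Let T_lip x y : `|T x - T y| <= M * `|x - y|.
Proof. by rewrite -{1}[x](subrKC y); exact: operator_lipschitz. Qed.

Let p_lip x y : `|r x - r y| <= C * (M * `|x - y| * c0) /\
  `|(p x).2 - (p y).2| <= C * (M * `|x - y| * c0).
Proof.
apply: sol_diff (pP x) (pP y) _; rewrite subrr sub0r normrN.
apply: le_trans (clin_ub _ _) _.
by rewrite ler_pM ?T_lip//; exact: (p_bound y).1.
Qed.

Let dT_ub x h v : `|dT x h v| <= M * `|h| * `|v|.
Proof.
apply: le_trans (clin_ub _ _) _; rewrite ler_wpM2r//.
by apply: le_trans (clin_ub _ _) _; rewrite ler_wpM2r.
Qed.

(** Formally differentiating T(x) r(x) + B u(x) = F in direction h gives this linearized problem,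
    whose solution is the candidate derivative of the state. *)
Let q_ex : exists q : X -> X -> H * U,
  forall x h, saddle_solution B Uh (T x) (- dT x h (r x)) (q x h).
Proof.
have /choice[q qP] (xh : X * X) : exists q,
    saddle_solution B Uh (T xh.1) (- dT xh.1 xh.2 (r xh.1)) q.
  have := saddle_exists Uh_findim alpha_gt0 (- dT xh.1 xh.2 (r xh.1))
    (T_stable xh.1).
  exact.
by exists (fun x h => q (x, h)) => x h; exact: qP (x, h).
Qed.

Let q := sval (cid q_ex).

Let qP x h : saddle_solution B Uh (T x) (- dT x h (r x)) (q x h).
Proof. exact: (svalP (cid q_ex)). Qed.

Let q_linear x : linear (fun h => (q x h).2).
Proof.
move=> a h1 h2; rewrite (_ : q x _ = a *: q x h1 + q x h2)//.
apply: (saddle_unique Uh_findim alpha_gt0 beta_gt0 MT_ge0 B_below (T_stable x)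
  (T_bound x) (qP _ _)).
rewrite (_ : - _ = a *: (- dT x h1 (r x)) + - dT x h2 (r x)).
  exact: saddle_solutionP.
apply: clin_ext => v; rewrite clin_argD clin_argZ.
by rewrite clinN !clinD !clinZ !clinN scalerN opprD.
Qed.

Let q_bound x h : `|(q x h).1| <= C * (M * `|h| * c0) /\
  `|(q x h).2| <= C * (M * `|h| * c0).
Proof.
apply: sol_bound (qP x h) _; rewrite normrN.
apply: le_trans (dT_ub _ _ _) _; rewrite ler_wpM2l ?mulr_ge0//.
exact: (p_bound x).1.
Qed.

(** The perturbed data split into three terms, with dT x - dT y, r x - r y and T x - T y
    respectively. The first contributes [k * c0], each of the others [C * M ^+ 2 * c0]. *)
Let q_lip x y h : `|(q x h).2 - (q y h).2| <=
  C * ((k * c0 + 2 * (C * M ^+ 2 * c0)) * `|x - y| * `|h|).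
Proof.
have [] := sol_diff (qP x h) (qP y h)
   (N := (k * c0 + 2 * (C * M ^+ 2 * c0)) * `|x - y| * `|h|) _; last by [].
rewrite (_ : _ - _ = - ((dT x - dT y) h (r x)) - dT y h (r x - r y)
   - (T x - T y) (q y h).1); last first.
  apply: clin_ext => v; rewrite clin_argB !(clinB, clinN, clinD).
  by ring.
have e1 : `|(dT x - dT y) h (r x)| <= k * `|x - y| * `|h| * c0.
  apply: le_trans (clin_ub _ _) _; apply: ler_pM => //.
    by apply: le_trans (clin_ub _ _) _; rewrite ler_wpM2r.
  exact: (p_bound x).1.
have e2 : `|dT y h (r x - r y)| <= M * `|h| * (C * (M * `|x - y| * c0)).
  apply: le_trans (dT_ub _ _ _) _; rewrite ler_wpM2l ?mulr_ge0//.
  exact: (p_lip x y).1.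
have e3 : `|(T x - T y) (q y h).1| <= M * `|x - y| * (C * (M * `|h| * c0)).
  apply: le_trans (clin_ub _ _) _; apply: ler_pM => //; exact: (q_bound y h).1.
apply: le_trans (ler_normB _ _) _.
apply: le_trans (lerD (ler_normB _ _) (lexx _)) _.
rewrite normrN; apply: le_trans (lerD (lerD e1 e2) e3) _.
by rewrite le_eqVlt; apply/orP; left; apply/eqP; ring.
Qed.

(** Up to sign, the remainder solves the problem at x with data (T(x+h) - T x - dT x h) r(x+h) + dT
    x h (r(x+h) - r x). Both terms are of second order in h. *)
Let q_taylor x h : `|(p (x + h)).2 - (p x).2 - (q x h).2| <=
  C * ((k * c0 + C * M ^+ 2 * c0) * `|h| ^+ 2).
Proof.
have xh : x - (x + h) = - h by rewrite opprD addNKr.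
have s1 : saddle_solution B Uh (T x) ((T (x + h) - T x) (r (x + h)))
    (p x - p (x + h)).
  apply: saddle_solutionB (pP x) (pP (x + h)) _ => // v.
  by rewrite subrr sub0r opprB !clinB.
have [] := sol_bound (saddle_solutionP Uh_findim 1 s1 (qP x h))
   (N := (k * c0 + C * M ^+ 2 * c0) * `|h| ^+ 2) _; last first.
  by move=> _; rewrite /= scale1r -normrN opprD opprB.
rewrite scale1r (_ : _ + _ = (T (x + h) - T x - dT x h) (r (x + h)) +
   dT x h (r (x + h) - r x)); last first.
  apply: clin_ext => v; rewrite clin_argB !(clinB, clinN, clinD).
  by ring.
have e1 : `|(T (x + h) - T x - dT x h) (r (x + h))| <= k * `|h| ^+ 2 * c0.
  apply: le_trans (clin_ub _ _) _; apply: ler_pM => //.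
    exact: operator_taylor.
  exact: (p_bound _).1.
have e2 : `|dT x h (r (x + h) - r x)| <= M * `|h| * (C * (M * `|h| * c0)).
  apply: le_trans (dT_ub _ _ _) _; rewrite ler_wpM2l ?mulr_ge0//.
  by rewrite distrC -[X in C * (_ * X * _)]normrN -xh; exact: (p_lip _ _).1.
apply: le_trans (ler_normD _ _) _; apply: le_trans (lerD e1 e2) _.
by rewrite le_eqVlt; apply/orP; left; apply/eqP; ring.
Qed.

Lemma saddle_solution_smooth :
  exists D c, smooth_bounded (fun x => (p x).2) D c.
Proof.
have q2 x h : `|(q x h).2| <= C * (M * c0) * `|h|.
  by apply: le_trans (q_bound x h).2 _; rewrite mulrAC -!mulrA.
pose c1 := C * (M * c0).
(* The absolute value makes [c2] nonnegative whatever the sign of [k]; [c2] also dominates the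
   smaller Taylor constant. *)
pose c2 := C * (`|k| * c0 + 2 * (C * M ^+ 2 * c0)).
have c1_ge0 : 0 <= c1 by rewrite !mulr_ge0.
have c2_ge0 : 0 <= c2 by rewrite mulr_ge0// addr_ge0// ?mulr_ge0 ?exprn_ge0.
exists (fun x => mk_clin (q_linear x) (q2 x)), (c0 + c1 + c2).
have le0 : c0 <= c0 + c1 + c2 by rewrite -addrA lerDl addr_ge0.
have le1 : c1 <= c0 + c1 + c2 by rewrite -addrA addrCA lerDl addr_ge0.
have le2 : c2 <= c0 + c1 + c2 by rewrite lerDr addr_ge0.
have k2 : C * (k * c0 + 2 * (C * M ^+ 2 * c0)) <= c2.
  by rewrite ler_wpM2l// lerD2r ler_wpM2r// ler_norm.
have k3 : C * (k * c0 + C * M ^+ 2 * c0) <= c2.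
  apply: le_trans _ k2; rewrite ler_wpM2l// lerD2l ler_peMl ?ler1n//.
  by rewrite !mulr_ge0// exprn_ge0.
split=> [x|x y|x h|x y h|x h] /=.
- exact: le_trans (p_bound x).2 le0.
- apply: le_trans (p_lip x y).2 _; apply: le_trans _ (ler_wpM2r _ le1) => //.
  by rewrite le_eqVlt; apply/orP; left; apply/eqP; rewrite /c1; ring.
- exact: le_trans (q2 x h) (ler_wpM2r _ le1).
- apply: le_trans (q_lip x y h) _; rewrite !mulrA !ler_wpM2r//.
  by apply: le_trans _ le2; rewrite -!mulrA in k2 *; exact: k2.
- apply: le_trans (q_taylor x h) _; rewrite mulrA ler_wpM2r ?exprn_ge0//.
  exact: le_trans k3 le2.
Qed.

End ParametricSaddle.

(** * Smoothness of the tracking term *)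

Definition quadratically_smooth (R : realType) (X : normedModType R)
    (g : X -> R) (dg : X -> {clin X -> R}) (K : R) : Prop :=
  (forall x h, `|g (x + h) - g x - dg x h| <= K / 2 * `|h| ^+ 2) /\
  (forall x y, `|dg x - dg y| <= K * `|x - y|).

Section Tracking.
Context {R : realType} {X U : normedModType R} {Z : hilbertType R}.
Variables (u : X -> U) (D : X -> {clin X -> U}) (c : R).
Hypothesis u_smooth : smooth_bounded u D c.
Variables (Q : {clin U -> Z}) (zo : Z).

(** The misfit w = Q u - z_o is bounded by m and Lipschitz with constant n. With d the increment of
    w, the remainder is (w x, d - Q (D x h)) + |d|^2 / 2, at most (m n + n^2) |h|^2. *)
Lemma tracking_smooth : exists dg K,
  0 <= K /\ quadratically_smooth (fun x => 2^-1 * `|Q (u x) - zo| ^+ 2) dg K.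
Proof.
have [u_le u_lip D_le D_lip u_taylor] := u_smooth.
have c_ge0 : 0 <= c := le_trans (normr_ge0 _) (u_le 0).
pose w x := Q (u x) - zo; pose m := `|Q| * c + `|zo|; pose n := `|Q| * c.
have n_ge0 : 0 <= n by rewrite mulr_ge0.
have m_ge0 : 0 <= m by rewrite addr_ge0.
have wB x y : w x - w y = Q (u x - u y).
  by rewrite /w clin_argB opprD opprK addrACA addNr addr0.
have w_le x : `|w x| <= m.
  rewrite (le_trans (ler_normB _ _))// lerD2r (le_trans (clin_ub _ _))//.
  by rewrite ler_wpM2l.
have Q_le v N t : `|v| <= c * N * t -> `|Q v| <= n * N * t.
  by move=> vN; rewrite (le_trans (clin_ub _ _))// -!mulrA ler_wpM2l// mulrA.
have w_lip x y : `|w x - w y| <= n * `|x - y|.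
  by rewrite wB -[leRHS]mulr1; apply: Q_le; rewrite mulr1.
have QD_le x h : `|Q (D x h)| <= n * `|h|.
  by rewrite -[leRHS]mulr1; apply: Q_le; rewrite mulr1.
have dg_linear x : linear (fun h => inner (w x) (Q (D x h))).
  by move=> k h1 h2; rewrite !clin_argD !clin_argZ innerDr innerZr.
have dg_bound x h : `|inner (w x) (Q (D x h))| <= m * n * `|h|.
  by rewrite (le_trans (inner_le _ _))// -mulrA ler_pM.
(* The factor 2 matches the remainder bound K/2; the derivative is even Lipschitz with K/2. *)
pose K := 2 * (m * n + n ^+ 2).
have K_ge0 : 0 <= K by rewrite mulr_ge0// addr_ge0 ?mulr_ge0 ?exprn_ge0.
exists (fun x => mk_clin (dg_linear x) (@dg_bound x)), K; split=> //; split.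
  move=> x h; rewrite -[2^-1 * _]/(2^-1 * `|w (x + h)| ^+ 2) -/(w x) /=.
  set d := w (x + h) - w x.
  have dE : w (x + h) = w x + d by rewrite subrKC.
  have -> : 2^-1 * `|w (x + h)| ^+ 2 - 2^-1 * `|w x| ^+ 2 -
      inner (w x) (Q (D x h)) =
      inner (w x) (d - Q (D x h)) + 2^-1 * `|d| ^+ 2.
    by rewrite dE normD_sqr (innerBr _ d); field.
  have d_le : `|d| <= n * `|h|.
    by rewrite (le_trans (w_lip _ _))// addrAC subrr add0r.
  have dD : `|d - Q (D x h)| <= n * `|h| * `|h|.
    by rewrite /d wB -clin_argB; apply: Q_le; rewrite -mulrA -expr2.
  rewrite (le_trans (ler_normD _ _))//.
  have -> : K / 2 * `|h| ^+ 2 = m * (n * `|h| * `|h|) + (n * `|h|) ^+ 2.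
    by rewrite /K; field.
  rewrite lerD//; first by rewrite (le_trans (inner_le _ _))// ler_pM.
  rewrite ger0_norm ?mulr_ge0 ?exprn_ge0 ?invr_ge0//.
  apply: le_trans (_ : `|d| ^+ 2 <= _).
    by rewrite ler_piMl ?exprn_ge0// invf_le1// ler1n.
  by rewrite ler_sqr ?nnegrE ?mulr_ge0.
move=> x y; apply: clin_le => [|h]; first by rewrite mulr_ge0.
rewrite clinB /=.
have -> : inner (w x) (Q (D x h)) - inner (w y) (Q (D y h)) =
    inner (w x - w y) (Q (D x h)) + inner (w y) (Q (D x h - D y h)).
  by rewrite (innerBl (w x)) clin_argB innerBr addrA subrK.
have h1 : `|inner (w x - w y) (Q (D x h))| <= n * `|x - y| * (n * `|h|).
  by rewrite (le_trans (inner_le _ _))// ler_pM.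
have h2 : `|inner (w y) (Q (D x h - D y h))| <= m * (n * `|x - y| * `|h|).
  by rewrite (le_trans (inner_le _ _))// ler_pM//; exact: Q_le.
apply: le_trans (ler_normD _ _) _; apply: le_trans (lerD h1 h2) _.
have -> : n * `|x - y| * (n * `|h|) + m * (n * `|x - y| * `|h|) =
  2^-1 * (K * `|x - y| * `|h|) by rewrite /K; field.
have t0 : 0 <= K * `|x - y| * `|h| by rewrite mulr_ge0// mulr_ge0.
by rewrite ler_piMl// invf_le1// ler1n.
Qed.

End Tracking.

(** * The regularized reduced cost and its quasi-minimizers *)

Section QuadraticRegularization.
Context {R : realType} {X : hilbertType R}.
Variables (g : X -> R) (dg : X -> {clin X -> R}) (K alpha : R).
Hypotheses (g_smooth : quadratically_smooth g dg K) (K_alpha : K < alpha).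

Let j x := g x + alpha / 2 * `|x| ^+ 2.
Let dj x : {clin X -> R} := dg x + alpha *: inner_clin x.

Let dj_E x h : dj x h = dg x h + alpha * inner x h.
Proof. by []. Qed.

Let j_taylor x h :
  `|j (x + h) - j x - dj x h - alpha / 2 * `|h| ^+ 2| <= K / 2 * `|h| ^+ 2.
Proof.
rewrite (_ : _ - _ = g (x + h) - g x - dg x h); first exact: g_smooth.1.
by rewrite dj_E /j normD_sqr; field.
Qed.

(** The regularizer contributes exactly alpha/2 |h|^2 at second order, and the remainder of [g] can
    take away at most K/2 |h|^2. *)
Lemma regularized_ge x h :
  j x + dj x h + (alpha - K) / 2 * `|h| ^+ 2 <= j (x + h).
Proof. by have := j_taylor x h; rewrite ler_norml => /andP[]; lra. Qed.

Lemma regularized_le x h :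
  j (x + h) <= j x + dj x h + (alpha + K) / 2 * `|h| ^+ 2.
Proof. by have := j_taylor x h; rewrite ler_norml => /andP[]; lra. Qed.

Lemma regularized_gateaux x : is_gateaux j x (dj x).
Proof.
apply: (@is_gateaux_quadratic _ _ _ _ _ _ ((`|alpha| + K) / 2)) => h.
have -> : j (x + h) - j x - dj x h =
  (j (x + h) - j x - dj x h - alpha / 2 * `|h| ^+ 2) + alpha / 2 * `|h| ^+ 2.
  by rewrite subrK.
apply: le_trans (ler_normD _ _) _.
have e : `|alpha / 2 * `|h| ^+ 2| <= `|alpha| / 2 * `|h| ^+ 2.
  rewrite normrM [X in _ * X]ger0_norm ?exprn_ge0//.
  by rewrite normrM [X in _ * X * _]ger0_norm ?invr_ge0.
apply: le_trans (lerD (j_taylor x h) e) _.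
by rewrite le_eqVlt; apply/orP; left; apply/eqP; field.
Qed.

Lemma regularized_lipschitz : (`|alpha| + K).-lipschitz dj.
Proof.
move=> [x y] _ /=.
have -> : dj x - dj y = (dg x - dg y) + alpha *: inner_clin (x - y).
  apply: clin_ext => h; rewrite -[LHS]/(dj x h - dj y h) !dj_E.
  rewrite -[RHS]/(dg x h - dg y h + alpha * inner (x - y) h) innerBl.
  by ring.
apply: le_trans (ler_normD _ _) _; rewrite addrC mulrDl lerD ?g_smooth.2//.
rewrite normrZ ler_wpM2l//; apply: clin_le => // h; exact: inner_le.
Qed.

(** The regularizer contributes alpha |x - y|^2 to the pairing, from which the Lipschitz bound on
    [dg] subtracts at most K |x - y|^2. *)
Lemma regularized_strongly_convex : strongly_convex_deriv dj (alpha - K).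
Proof.
move=> x y; rewrite clinB !dj_E.
have -> : dg x (x - y) + alpha * inner x (x - y) -
    (dg y (x - y) + alpha * inner y (x - y)) =
    (dg x - dg y) (x - y) + alpha * `|x - y| ^+ 2.
  by rewrite clinB -inner_norm (innerBl x y (x - y)); ring.
have := clin_ub (dg x - dg y) (x - y).
have := ler_wpM2r (normr_ge0 (x - y)) (g_smooth.2 x y).
rewrite ler_norml -mulrA -expr2 => h1 /andP[h2 _]; lra.
Qed.

Hypotheses (g_ge0 : forall x, 0 <= g x) (K_ge0 : 0 <= K).

Let alpha_gt0 : 0 < alpha. Proof. exact: le_lt_trans K_ge0 K_alpha. Qed.

Let j_ge0 x : 0 <= j x.
Proof. by rewrite addr_ge0// mulr_ge0 ?exprn_ge0// divr_ge0// ltW. Qed.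

Lemma regularized_minimizer : exists x, minimizer j x /\ dj x = 0.
Proof.
have [|x y|x jx] := @strongly_convex_minimizer _ _ j dj (alpha - K) _ _ 0 j_ge0.
- by rewrite subr_gt0.
- by have := regularized_ge x (y - x); rewrite subrKC.
exists x; split=> //; apply: minimizer_stationary jx _ => h.
exact: regularized_le.
Qed.

(** At a stationary point the lower quadratic bound has no linear term, so the excess cost controls
    the squared distance. *)
Let dist_le x xb : dj xb = 0 ->
  (alpha - K) / 2 * `|xb - x| ^+ 2 <= j x - j xb.
Proof.
move=> d0; have := regularized_ge xb (x - xb); rewrite subrKC distrC.
by rewrite (_ : dj xb _ = 0) ?d0//; lra.
Qed.

Lemma regularized_unique xb : minimizer j xb -> dj xb = 0 ->
  unique (minimizer j) xb.
Proof.
move=> jxb d0; split=> // x jx; have := dist_le x d0.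
have := jx xb => h1 h2; apply/eqP; rewrite -subr_eq0 -normr_eq0 -sqrf_eq0.
rewrite eq_le sqr_ge0 andbT -(@pmulr_rle0 _ ((alpha - K) / 2)).
  by lra.
by rewrite divr_gt0// subr_gt0.
Qed.

(** The infimum is finite because [j] is nonnegative, and some value comes within delta/2 of it; M
    need not be closed. *)
Lemma quasi_minimizer_exists (M : set X) delta : M !=set0 -> 0 < delta ->
  exists x, quasi_minimizer j M delta x.
Proof.
move=> [x0 Mx0] d0.
have hi : has_inf [set j x | x in M].
  by split; [exists (j x0), x0 | exists 0 => _ [x _ <-]].
have [|_ [x Mx <-] jx] := @inf_adherent _ _ (delta / 2) _ hi.
  by rewrite divr_gt0.
by exists x; split=> //; exact: ltW.
Qed.

Lemma quasi_minimizer_dist (M : set X) delta xb x : M !=set0 ->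
  dj xb = 0 -> quasi_minimizer j M delta x ->
  `|xb - x| <= Num.sqrt ((alpha + K) / (alpha - K) *
    inf [set `|xb - y| ^+ 2 | y in M] + delta / (alpha - K)).
Proof.
move=> [x0 Mx0] dxb [Mx jx].
have gam : 0 < alpha - K by rewrite subr_gt0.
have ell : 0 < alpha + K by rewrite ltr_wpDr.
rewrite -[leLHS]ger0_norm// -sqrtr_sqr ler_wsqrtr//.
set I := inf [set `|_ - _| ^+ 2 | _ in _].
have inf_le y : M y ->
    inf [set j x | x in M] <= j xb + (alpha + K) / 2 * `|xb - y| ^+ 2.
  move=> My; have : inf [set j x | x in M] <= j y.
    by apply: ge_inf; [exists 0 => _ [z _ <-]|exists y].
  move=> /le_trans; apply; have := regularized_le xb (y - xb).
  by rewrite subrKC distrC (_ : dj xb _ = 0) ?dxb// addr0.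
(* Divided by alpha + K, the left-hand side is a lower bound of all squared distances from [xb] to
   M, hence of their infimum. *)
have key : (alpha - K) * `|xb - x| ^+ 2 - delta <= (alpha + K) * I.
  rewrite -ler_pdivrMl//; apply: lb_le_inf.
    by exists (`|xb - x0| ^+ 2), x0.
  move=> _ [y My <-]; rewrite ler_pdivrMl//.
  have := inf_le y My; have := dist_le x dxb; lra.
by rewrite mulrAC -mulrDl ler_pdivlMr// mulrC; lra.
Qed.

End QuadraticRegularization.

(** * From the bilinear forms to the abstract saddle-point problem *)

(** For w nonzero, a bound c w v <= M |v| keeps every quotient, hence the inner supremum, below M /
    |w|. This converts the extended-real conditions into the form used by [kernel_stable] and
    [B_below]. *)
Lemma infsup_le (R : realType) (W1 W2 : normedModType R) (c : W1 -> W2 -> R)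
    (S1 : set W1) (S2 : set W2) (al M : R) (w : W1) :
  (al%:E <= infsup c S1 S2)%E -> S1 w -> 0 <= M ->
  (forall v, S2 v -> c w v <= M * `|v|) -> al * `|w| <= M.
Proof.
move=> al_le Sw M0 cM; have [->|w0] := eqVneq w 0.
  by rewrite normr0 mulr0.
have nw : 0 < `|w| by rewrite normr_gt0.
rewrite -ler_pdivlMr// -lee_fin (le_trans al_le)//.
apply: le_trans (ereal_inf_lbound _) _; first by exists w.
apply: ge_ereal_sup => _ [v [Sv v0] <-].
have nv : 0 < `|v| by rewrite normr_gt0.
rewrite lee_fin ler_pdivrMr ?mulr_gt0// mulrA divfK ?gt_eqF//.
exact: cM.
Qed.

Section FormRow.
Context {R : realType} {U V : normedModType R} (b : cbilin U V).

Lemma cbilin_row_clin w : b w \in @clin_pred R V R.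
Proof.
apply/asboolP; split=> [k x y|v]; first exact: (cbilin_bilinear b).2.
have pair_cvg : (w, v') @[v' --> v] --> (w, v).
  exact: (cvg_pair (cvg_cst w) cvg_id).
exact: (continuous_comp pair_cvg (@cbilin_continuous _ _ _ b (w, v))).
Qed.

Variable S : closed_subspace V.

Definition cbilin_row w : {clin S -> R} :=
  clin_restr S (Clin (cbilin_row_clin w)).

Lemma cbilin_row_linear : linear cbilin_row.
Proof.
by move=> k x y; apply: clin_ext => v; exact: (cbilin_bilinear b).1.
Qed.

HB.instance Definition _ :=
  GRing.isLinear.Build R U {clin S -> R} *:%R cbilin_row cbilin_row_linear.

End FormRow.

Theorem corollary2p12 (R : realType) (X U V Z : hilbertType R)
  (f : {clin V -> R}) (a : X -> cbilin V V) (b : cbilin U V)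
  (Uh : set U) (Vh : closed_subspace V)
  (Uh_findim : findim_subspace Uh)
  (betah : R) (alphah : X -> R)
  (betah_gt0 : 0 < betah) (alphah_gt0 : forall xi, 0 < alphah xi)
  (a_infsup : forall xi,
     ((alphah xi)%:E <=
      infsup (fun v1 v2 : Vh => a xi (val v1) (val v2))
        (@kernel_b R U V b Uh Vh) (@kernel_b R U V b Uh Vh))%E)
  (a_nondeg : forall xi,
     [set v2 : Vh | kernel_b b Uh v2 /\
        forall v1 : Vh, kernel_b b Uh v1 -> a xi (val v1) (val v2) = 0]
     = [set 0])
  (b_infsup :
     (betah%:E <= infsup (fun (wh : U) (v : Vh) => b wh (val v)) Uh setT)%E)
  (A' : X -> {clin X -> {clin Vh -> {clin Vh -> R}}})
  (A_gateaux : forall xi, is_gateaux (fun eta => form_op (a eta) Vh) xi (A' xi))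
  (A_bounded : [bounded form_op (a xi) Vh | xi in [set: X]])
  (A'_bounded : [bounded A' xi | xi in [set: X]])
  (alphah_bounded : [bounded (alphah xi)^-1 | xi in [set: X]])
  (A'_lipschitz : exists k : R, k.-lipschitz A')
  (Q : {clin U -> Z}) (zo : Z) :
  (forall xi, exists! p : Vh * U, state_problem a b f Uh xi p) /\
  exists2 alpha0 : R, 0 <= alpha0 &
    forall alpha : R, alpha0 < alpha ->
    let j := reduced_cost a b f Uh Vh Q zo alpha in
    exists (L gamma : R) (j' : X -> {clin X -> R}) (xibar : X),
      [/\ (0 < L /\ 0 < gamma),
          (forall xi, is_gateaux j xi (j' xi)),
          L.-lipschitz j',
          strongly_convex_deriv j' gamma &
      [/\ unique (minimizer j) xibar,
          j' xibar = 0,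
          (forall (M : set X) (delta : R), M !=set0 -> 0 < delta ->
             exists xin, quasi_minimizer j M delta xin) &
          forall (M : set X) (delta : R) (xin : X), M !=set0 -> 0 < delta ->
            quasi_minimizer j M delta xin ->
            `|xibar - xin| <=
              Num.sqrt (L / gamma * inf [set `|xibar - eta| ^+ 2 | eta in M]
                        + delta / gamma)]].
Proof.
have [MT MT0 A_le] := pinfty_ex_gt0 A_bounded.
have [M M0 A'_le] := pinfty_ex_gt0 A'_bounded.
have [m m0 al_le] := pinfty_ex_gt0 alphah_bounded.
have [k A'_lip] := A'_lipschitz.
pose B : {linear U -> {clin Vh -> R}} := cbilin_row b Vh.
pose T xi := form_op (a xi) Vh; pose F := clin_restr Vh f.
(* The uniform bound on the inverses gives one stability constant for all controls. *)
have al_ge xi : m^-1 <= alphah xi.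
  have ai : 0 < (alphah xi)^-1 by rewrite invr_gt0.
  rewrite -[leRHS]invrK lef_pV2 ?posrE//; apply: le_trans (ler_norm _) _.
  exact: (al_le xi I).
have T_stable xi : kernel_stable B Uh m^-1 (T xi).
  split=> [r N Kr N0 TN|v Kv Tv].
    apply: (@infsup_le _ _ _ _ _ _ _ _ _ _ Kr N0 TN).
    by apply: le_trans (a_infsup xi); rewrite lee_fin.
  have : [set v2 : Vh | kernel_b b Uh v2 /\
      forall v1 : Vh, kernel_b b Uh v1 -> a xi (val v1) (val v2) = 0] v by [].
  by rewrite a_nondeg.
have B_below u N : Uh u -> 0 <= N -> (forall v, B u v <= N * `|v|) ->
    betah * `|u| <= N.
  by move=> Uu N0 BN; apply: (infsup_le b_infsup Uu N0) => v _; exact: BN.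
have mV : 0 < m^-1 by rewrite invr_gt0.
have T_le xi : `|T xi| <= MT by exact: (A_le xi I).
have wellposed xi : exists! p : Vh * U, state_problem a b f Uh xi p.
  have [p pP] := saddle_exists Uh_findim mV F (T_stable xi).
  exists p; split=> // q qP.
  exact: (saddle_unique Uh_findim mV betah_gt0 (ltW MT0) B_below (T_stable xi)
    (T_le xi) pP qP).
split=> //.
(* [p] is the choice made inside [state_u], so its second component is the state; well-posedness
   ensures that [get] returns a solution. *)
pose p xi := get (state_problem a b f Uh xi : set (Vh * U)).
have pP xi : saddle_solution B Uh (T xi) F (p xi).
  have [q [qP _]] := wellposed xi.
  by apply: (@getPex _ (state_problem a b f Uh xi)); exists q.
have [D [c u_smooth]] :=
  @saddle_solution_smooth _ _ _ _ B Uh T A' F p m^-1 betah MT M k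
  Uh_findim mV betah_gt0 B_below T_stable T_le A_gateaux (fun x => A'_le x I)
  (fun x y => A'_lip (x, y) (conj I I)) pP.
have [dg [K [K_ge0 g_smooth]]] := tracking_smooth u_smooth Q zo.
(* [K] was obtained before alpha was introduced, so the threshold is independent of alpha. *)
exists K => // alpha K_alpha j.
have g_ge0 x : 0 <= 2^-1 * `|Q (p x).2 - zo| ^+ 2.
  by rewrite mulr_ge0// exprn_ge0.
have alpha_gt0 : 0 < alpha by exact: le_lt_trans K_ge0 K_alpha.
have [xb [jxb dxb]] := regularized_minimizer g_smooth K_alpha g_ge0 K_ge0.
exists (alpha + K), (alpha - K), (fun x => dg x + alpha *: inner_clin x), xb.
split.
- by split; [rewrite ltr_wpDr|rewrite subr_gt0].
- exact: regularized_gateaux g_smooth.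
- by have := regularized_lipschitz alpha g_smooth; rewrite gtr0_norm.
- exact: regularized_strongly_convex alpha g_smooth.
split=> //.
- exact: regularized_unique g_smooth K_alpha xb jxb dxb.
- move=> N delta; exact: (quasi_minimizer_exists K_alpha g_ge0 K_ge0).
- move=> N delta xin N0 d0 qx.
  exact: (quasi_minimizer_dist g_smooth K_alpha g_ge0 K_ge0 N0 dxb qx).
Qed.
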